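(* Let $b\ge n^2/m$. The learning graph $\mathcal G$ for $\mathsf{Triangle}$ described in the context, using $\mathsf{SparseLoad}$ for the first stage (Stage 0) of the Johnson construction and $\mathsf{DenseLoad}$ otherwise, has complexity over graphs with $m$ edges $$O\left(\sqrt{n\left(b^2\,\frac m{n^2}\log n+\frac{n^2}{b^2}\left(b+\frac{b^2(d_2)^2}{n^2}\right)\right)}\right),$$ where $d_2=\sqrt{\mathrm{Exp}_v[\,|N_v|^2\,]}$. Taking $b=n^{4/3}/(m\log n)^{1/3}$ leads to a complexity of $O(n^{5/6}(m\log n)^{1/6}+d_2\sqrt n)$.
   Context: **Problem.** An undirected graph $G$ on vertex set $V=[n]$ is encoded by $z\in\{0,1\}^N$, $N=\binom n2$, with $z_{ij}=1$ iff $ij$ is an edge. $\mathsf{Triangle}(G)=1$ iff $G$ has a triangle; the inputs are the graphs with $m$ edges. $N_v$ is the neighborhood of $v$ in $G$ and $\mathrm{Exp}_v$ the average over $v$ uniform in $V$, so $d_2$ is a parameter of the input graph, not used in the construction; the bound on the negative complexity on an input graph involves the $d_2$ of that graph. The integer $b$ satisfies $2\le b\le n$. **Learning graphs.** Let $f:Z\to\{0,1\}$, $Z\subseteq\{0,1\}^N$, $Y=f^{-1}(1)$; $z_S$ is the restriction of $z$ to $S$ and $|z_S|$ its Hamming weight. A $1$-certificate for $f$ on $y\in Y$ is $I\subseteq[N]$ with $f(z)=1$ for every $z\in Z$ with $z_I=y_I$. An (extended) learning graph for $f$ is a rooted directed acyclic graph $(\mathcal V,\mathcal E)$ with: (i)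 vertex labels $\mathcal S(v)\subseteq[N]$, the root being labelled $\emptyset$, and $\mathcal S(v)=\mathcal S(u)\cup\{j\}$ for some $j\notin\mathcal S(u)$ for each edge $(u,v)$ (the edge loads $j$); (ii) weights $w_z^b(u,v)\ge0$ ($z\in Z$, $b\in\{0,1\}$) depending on $z$ only through $z_{\mathcal S(v)}$, with $w_x^0(u,v)=w_y^1(u,v)$ whenever $x\in Z\setminus Y$, $y\in Y$, $x_{\mathcal S(u)}=y_{\mathcal S(u)}$ and $x_j\ne y_j$, where $(u,v)$ loads $j$; (iii) for each $y\in Y$, a unit flow $p_y\ge0$ from the root, zero on edges with $w_y^1=0$, each sink of which has a label containing a $1$-certificate for $f$ on $y$. Put $C^0(\mathcal G,x)=\sum_ew_x^0(e)$ (negative complexity on $x\in f^{-1}(0)$), $C^1(\mathcal G,y)=\sum_ep_y(e)^2/w_y^1(e)$ (positive complexity on $y\in f^{-1}(1)$), $C^0(\mathcal G)=\max_{x\in f^{-1}(0)}C^0(\mathcal G,x)$, $C^1(\mathcal G)=\max_{y\in f^{-1}(1)}C^1(\mathcal G,y)$. The complexity of $\mathcal G$ is $\sqrt{C^0(\mathcal G)C^1(\mathcal G)}$. Edges between vertices with equal labels (empty transitions) are allowed and contribute to no complexity. **Loading.** For $S=\{s_1,\dots,s_l\}$, both $\mathsf{DenseLoad}_S$ and $\mathsf{SparseLoad}_S$ are the path loading $s_1,\dots,s_l$ in this order, with unit flow. In $\mathsf{DenseLoad}_S$ all weights are $l$. In $\mathsf{SparseLoad}_S$ the edge loading $s_j$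 has weight $w^b_z=3(|z_{\{s_1,\dots,s_{j-1}\}}|+1)\log(l+1)$ if $z_{s_j}=b$ and $w_z^b=3l\log(l+1)$ if $z_{s_j}=1-b$. They are used below as single (super) edges, to be replaced by the paths. **OR construction.** Given learning graphs $\mathcal G_i$ for functions $f_i$: join a new root by empty transitions to the root of each $\mathcal G_i$ and multiply all weights in $\mathcal G_i$ by $C^1(\mathcal G_i)$. On a positive input of $\bigvee_if_i$ the flow goes to one component with $f_i=1$ and then follows the flow of that $\mathcal G_i$. **The learning graph $\mathcal G$.** It is the OR over $w\in V$ of learning graphs $\mathcal G_w$ deciding whether $w$ is a vertex of a triangle. $\mathcal G_w$ is the following Johnson construction on $b$-subsets $B$ of $V$, with $I_w(B')=\{w\}\times B'$ (the pairs between $w$ and $B'$). Stage 0: for each $(b-2)$-subset $B'$ of $V$, a super edge loading $I_w(B')$ from the root to a vertex $B'$. Stages $\ell=1,2$: for each $(b-3+\ell)$-subset $B'$ and each $j\in V\setminus B'$, a super edge loading $I_w(B'\cup\{j\})\setminus I_w(B')$ from $B'$ to $B'\cup\{j\}$. Final stage: at each $b$-subset $B$, plug the OR, over the pairs $(u,v)\in(N_w\cap B)^2$ (known from the pairs already loaded), of the single-edge learning graph loading $uv$; call $\mathcal G_{w,B}$ this plugged graph, and multiply its weights by $C^1(\mathcal G_{w,B})/\binom{n-2}{b-2}$. On a positive input where $w,j_1,j_2$ form a triangle, the flow in $\mathcal G_w$ goes uniformly to the $B'$ of Stage 0 disjoint from $\{j_1,j_2\}$, then adds $j_1$, then $j_2$,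 and then follows the plugged learning graphs (of the $B\supseteq\{j_1,j_2\}$). In each of Stages 0, 1, 2 the weights of each super edge $e$ are multiplied by $c^1(e)/n_{\rm used}$, where $c^1(e)$ is the maximal positive complexity of $e$ for unit flow and $n_{\rm used}$ is the number of super edges of the stage carrying flow on a positive input.
   Formalization: The first bound is proved for b ≤ cn with any fixed c < 1, the implied constant depending on c, because it fails when b/n tends to 1 (e.g. b = n, m = n²/4); in the second claim b is the stated value rounded to an integer, still with b ≥ n²/m. *)

(* Defs.v *)
From HB Require Import structures.
From mathcomp Require Import all_boot all_order all_algebra.
From mathcomp Require Import reals exp.
Set Implicit Arguments. Unset Strict Implicit. Unset Printing Implicit Defensive.
Import Order.TTheory GRing.Theory Num.Theory.
Local Open Scope ring_scope.

Definition input (I : finType) := {ffun I -> bool}.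

Definition agree (I : finType) (S : {set I}) (z z' : input I) : Prop :=
  forall i, i \in S -> z i = z' i.

(* The vertices of the learning graph are the elements of [V] reachable from
   the root.  [V] may have further elements, which are then isolated. *)
Record lgraph (R : realType) (I V : finType) := LGraph {
  lg_root : V;
  lg_label : V -> {set I};
  lg_edge : rel V;
  lg_weight : input I -> bool -> V -> V -> R;
  lg_flow : input I -> V -> V -> R }.

Section LearningGraphs.
Variables (R : realType) (I V : finType).
Implicit Types (G : lgraph R I V) (Z f : pred (input I)).

(* An edge that is not an empty transition. *)
Definition loads G : rel V :=
  fun u v => lg_edge G u v && (lg_label G u != lg_label G v).

Definition neg_cost G (x : input I) : R :=
  \sum_u \sum_(v | loads G u v) lg_weight G x false u v.

Definition pos_cost G (y : input I) : R :=
  \sum_u \sum_(v | loads G u v) lg_flow G y u v ^+ 2 / lg_weight G y true u v.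

(* All costs are nonnegative; a maximum over no input is 0. *)
Definition C0 Z f G : R := \big[Num.max/0]_(x | Z x && ~~ f x) neg_cost G x.
Definition C1 Z f G : R := \big[Num.max/0]_(y | Z y && f y) pos_cost G y.

Definition complexity Z f G : R := Num.sqrt (C0 Z f G * C1 Z f G).

Definition certificate Z f (y : input I) (S : {set I}) : Prop :=
  forall z, Z z -> agree S z y -> f z.

(* [f] matters on [Z] only. *)
Record is_learning_graph Z f G : Prop := IsLearningGraph {
  lg_acyclic : forall u v, lg_edge G u v -> ~~ connect (lg_edge G) v u;
  lg_rooted : forall u v, lg_edge G u v -> connect (lg_edge G) (lg_root G) u;
  lg_root_label : lg_label G (lg_root G) = set0;
  lg_edge_label : forall u v, lg_edge G u v ->
    lg_label G v = lg_label G u \/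
    exists2 j, j \notin lg_label G u & lg_label G v = j |: lg_label G u;
  lg_weight_ge0 : forall z b u v, Z z -> loads G u v ->
    0 <= lg_weight G z b u v;
  lg_weight_local : forall z z' b u v, Z z -> Z z' -> loads G u v ->
    agree (lg_label G v) z z' -> lg_weight G z b u v = lg_weight G z' b u v;
  lg_weight_compat : forall x y u v j, Z x -> ~~ f x -> Z y -> f y ->
    loads G u v -> lg_label G v = j |: lg_label G u ->
    agree (lg_label G u) x y -> x j != y j ->
    lg_weight G x false u v = lg_weight G y true u v;
  lg_flow_ge0 : forall y u v, Z y -> f y -> 0 <= lg_flow G y u v;
  lg_flow_edge : forall y u v, Z y -> f y ->
    ~~ lg_edge G u v -> lg_flow G y u v = 0;
  lg_flow_weight : forall y u v, Z y -> f y ->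
    loads G u v -> lg_weight G y true u v = 0 -> lg_flow G y u v = 0;
  lg_flow_unit : forall y, Z y -> f y -> \sum_v lg_flow G y (lg_root G) v = 1;
  lg_flow_sink : forall y v, Z y -> f y -> v != lg_root G ->
    \sum_u lg_flow G y u v = \sum_u lg_flow G y v u \/
    \sum_u lg_flow G y v u = 0 /\
    exists2 S : {set I}, S \subset lg_label G v & certificate Z f y S }.

End LearningGraphs.

(* [wt s z b k] is the weight w_z^b of the edge loading the [k]-th element
   (from 0) of the sequence [s]. *)
Definition loader (R : realType) (I : finType) :=
  seq I -> input I -> bool -> nat -> R.

Definition dense_load (R : realType) (I : finType) : loader R I :=
  fun s z b k => (size s)%:R.

Definition sparse_load (R : realType) (I : finType) : loader R I :=
  fun s z b k =>
    let a := [seq z i | i <- s] in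
    if nth false a k == b
    then 3 * (count id (take k a)).+1%:R * ln (size s).+1%:R
    else 3 * (size s)%:R * ln (size s).+1%:R.

Definition unit_pos_cost (R : realType) (I : finType) (wt : loader R I)
    (s : seq I) (y : input I) : R :=
  \sum_(k < size s) (wt s y true k)^-1.

Definition max_unit_pos_cost (R : realType) (I : finType)
    (Z f : pred (input I)) (wt : loader R I) (s : seq I) : R :=
  \big[Num.max/0]_(y | Z y && f y) unit_pos_cost wt s y.

(* [sk_weight u v] gives the weights along the path replacing the super edge
   [(u, v)], which loads the sequence [sk_load u v]. *)
Record skeleton (R : realType) (I W : finType) := Skeleton {
  sk_root : W;
  sk_label : W -> {set I};
  sk_edge : rel W;
  sk_load : W -> W -> seq I;
  sk_weight : W -> W -> input I -> bool -> nat -> R;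
  sk_flow : input I -> W -> W -> R }.

Section Expand.
Variables (R : realType) (I W : finType) (K : skeleton R I W).

(* [inr (u, v, k)], for [0 < k < size (sk_load K u v)], is the vertex reached
   after [k] steps on the path from [u] to [v]. *)
Local Notation xvertex := (W + W * W * 'I_#|I|)%type.

Definition expand_edge : rel xvertex := fun p q =>
  match p, q with
  | inl u, inl v => sk_edge K u v && (size (sk_load K u v) <= 1)%N
  | inl u, inr (u', v', k) =>
      [&& sk_edge K u' v', u == u', k == 1%N :> nat
        & (1 < size (sk_load K u' v'))%N]
  | inr (u, v, k), inr (u', v', k') =>
      [&& sk_edge K u v, (u, v) == (u', v'), (0 < k)%N, k' == k.+1 :> nat
        & (k' < size (sk_load K u v))%N]
  | inr (u, v, k), inl v' =>
      [&& sk_edge K u v, v == v', (0 < k)%N & k.+1 == size (sk_load K u v)]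
  end.

(* The super edge containing an edge, and its position on the path. *)
Definition expand_super (p q : xvertex) : W * W * nat :=
  match p, q with
  | inl u, inl v => (u, v, 0%N)
  | inl _, inr (u, v, _) => (u, v, 0%N)
  | inr (u, v, k), _ => (u, v, k : nat)
  end.

Definition expand : lgraph R I xvertex := {|
  lg_root := inl (sk_root K);
  lg_label := fun p : xvertex =>
    match p with
    | inl u => sk_label K u
    | inr (u, v, k) =>
        sk_label K u :|: [set i in take k (sk_load K u v)]
    end;
  lg_edge := expand_edge;
  lg_weight := fun z b p q =>
    let: (u, v, k) := expand_super p q in sk_weight K u v z b k;
  lg_flow := fun y p q =>
    if expand_edge p q
    then let: (u, v, _) := expand_super p q in sk_flow K y u v else 0 |}.

End Expand.

Section Combine.
Variables (R : realType) (I V T : finType).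

(* OR of the [G t], [P t], where [G t] is for the function [f t]; the flow on
   [y] goes to the component [sel y]. *)
Definition or_graph (Z : pred (input I)) (P : pred T)
    (f : T -> pred (input I)) (G : T -> lgraph R I V) (sel : input I -> T)
    : lgraph R I (option (T * V)%type) := {|
  lg_root := None;
  lg_label := fun p => if p is Some (t, v) then lg_label (G t) v else set0;
  lg_edge := fun p q =>
    match p, q with
    | None, Some (t, v) => P t && (v == lg_root (G t))
    | Some (t, u), Some (t', v) => [&& P t, t == t' & lg_edge (G t) u v]
    | _, None => false
    end;
  lg_weight := fun z b p q =>
    match p, q with
    | Some (t, u), Some (_, v) => C1 Z (f t) (G t) * lg_weight (G t) z b u v
    | _, _ => 0
    end;
  lg_flow := fun y p q =>
    match p, q with
    | None, Some (t, v) => ((t == sel y) && (v == lg_root (G t)))%:R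
    | Some (t, u), Some (t', v) =>
        if (t == t') && (t == sel y) then lg_flow (G t) y u v else 0
    | _, None => 0
    end |}.

(* [J] with [H t], weights multiplied by [c t], plugged at [pt t] for each [t]
   such that [P t].  The root of [H t] is joined to [pt t] by an empty
   transition instead of being identified with it. *)
Definition plug (V' : finType) (J : lgraph R I V) (P : pred T) (pt : T -> V)
    (H : T -> lgraph R I V') (c : T -> R)
    : lgraph R I (V + T * V')%type :=
  let inflow y t := \sum_u lg_flow J y u (pt t) in {|
  lg_root := inl (lg_root J);
  lg_label := fun p =>
    match p with
    | inl u => lg_label J u
    | inr (t, u) => lg_label J (pt t) :|: lg_label (H t) u
    end;
  lg_edge := fun p q =>
    match p, q with
    | inl u, inl v => lg_edge J u v
    | inl u, inr (t, v) => [&& P t, u == pt t & v == lg_root (H t)]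
    | inr (t, u), inr (t', v) => [&& P t, t == t' & lg_edge (H t) u v]
    | inr _, inl _ => false
    end;
  lg_weight := fun z b p q =>
    match p, q with
    | inl u, inl v => lg_weight J z b u v
    | inr (t, u), inr (_, v) => c t * lg_weight (H t) z b u v
    | _, _ => 0
    end;
  lg_flow := fun y p q =>
    match p, q with
    | inl u, inl v => lg_flow J y u v
    | inl u, inr (t, v) =>
        if [&& P t, u == pt t & v == lg_root (H t)] then inflow y t else 0
    | inr (t, u), inr (t', v) =>
        if P t && (t == t') then inflow y t * lg_flow (H t) y u v else 0
    | inr _, inl _ => 0
    end |}.

End Combine.

Definition vpair (n : nat) : finType := {e : {set 'I_n} | #|e| == 2%N}.

Definition adj (n : nat) (z : input (vpair n)) (u v : 'I_n) : bool :=
  [exists e : vpair n, (val e == [set u; v]) && z e].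

Definition nbh (n : nat) (z : input (vpair n)) (v : 'I_n) : {set 'I_n} :=
  [set u | adj z v u].

Definition with_edges (n m : nat) : pred (input (vpair n)) :=
  fun z => #|[set e | z e]| == m.

Definition is_triangle (n : nat) (z : input (vpair n)) (u v w : 'I_n) : bool :=
  [&& adj z u v, adj z u w & adj z v w].

Definition in_triangle (n : nat) (w : 'I_n) : pred (input (vpair n)) :=
  fun z => [exists u, exists v, is_triangle z w u v].

Definition triangle (n : nat) : pred (input (vpair n)) :=
  fun z => [exists w, exists u, exists v, is_triangle z w u v].

Definition in_triangle_of (n : nat) (w : 'I_n) (B : {set 'I_n}) :
    pred (input (vpair n)) :=
  fun z => [exists u in B, exists v in B, is_triangle z w u v].

Definition d2 (R : realType) (n : nat) (z : input (vpair n)) : R :=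
  Num.sqrt ((\sum_(v < n) #|nbh z v|%:R ^+ 2) / n%:R).

(* I_w(B).  There is no pair when [v = w], as [ [set w; w] ] has one element. *)
Definition star (n : nat) (w : 'I_n) (B : {set 'I_n}) : {set vpair n} :=
  [set e : vpair n | [exists v in B, val e == [set w; v]]].

(* The singleton of the pair uv, if [u != v]. *)
Definition pair_set (n : nat) (u v : 'I_n) : {set vpair n} :=
  [set e : vpair n | val e == [set u; v]].

(* The arbitrary choices in the construction: the order in which a set is
   loaded, the vertex w to whose component the flow goes, the two vertices
   (j_1, j_2) completing w to a triangle, and the component of the OR plugged
   at B to which the flow goes. *)
Record choices (n : nat) := Choices {
  ch_order : {set vpair n} -> seq (vpair n);
  ch_apex : input (vpair n) -> 'I_n;
  ch_base : 'I_n -> input (vpair n) -> 'I_n * 'I_n;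
  ch_last : 'I_n -> {set 'I_n} -> input (vpair n) -> 'I_n * 'I_n;
  ch_orderP : forall S, perm_eq (ch_order S) (enum S);
  ch_apexP : forall y, triangle y -> in_triangle (ch_apex y) y;
  ch_baseP : forall w y, in_triangle w y ->
    is_triangle y w (ch_base w y).1 (ch_base w y).2;
  ch_lastP : forall w B y, in_triangle_of w B y ->
    [/\ (ch_last w B y).1 \in B, (ch_last w B y).2 \in B
      & is_triangle y w (ch_last w B y).1 (ch_last w B y).2] }.

Section TriangleGraph.
Variables (R : realType) (n m b : nat) (ch : choices n).

Local Notation Z := (@with_edges n m).

(* Stages 0, 1, 2 have super edges between the root [None] and the subsets
   [Some B]. *)
Local Notation jvertex := (option {set 'I_n}).

Definition super_edge (l : nat) : rel jvertex := fun u v =>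
  match u, v with
  | None, Some B => (l == 0%N) && (#|B| + 2 == b)%N
  | Some B, Some B' =>
      [&& (0 < l)%N, (#|B| + 3 == b + l)%N & [exists j in ~: B, B' == j |: B]]
  | _, None => false
  end.

Definition stage (u : jvertex) : nat :=
  if u is Some B then (#|B| + 3 - b)%N else 0%N.

Definition jlabel (w : 'I_n) (u : jvertex) : {set vpair n} :=
  if u is Some B then star w B else set0.

Definition jload (w : 'I_n) (u v : jvertex) : seq (vpair n) :=
  ch_order ch (jlabel w v :\: jlabel w u).

Definition jloader (u : jvertex) : loader R (vpair n) :=
  if u is None then @sparse_load R (vpair n) else @dense_load R (vpair n).

Definition start_sets (w : 'I_n) (y : input (vpair n)) : {set {set 'I_n}} :=
  let: (j1, j2) := ch_base ch w y in
  [set B : {set 'I_n} | [&& (#|B| + 2 == b)%N, j1 \notin B & j2 \notin B]].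

Definition jflow (w : 'I_n) (y : input (vpair n)) (u v : jvertex) : R :=
  let: (j1, j2) := ch_base ch w y in
  let A := start_sets w y in
  let q := #|A|%:R^-1 in
  match u, v with
  | None, Some B => if B \in A then q else 0
  | Some B, Some B' =>
      if (B \in A) && (B' == j1 |: B)
         || [exists B0 in A, (B == j1 |: B0) && (B' == j2 |: (j1 |: B0))]
      then q else 0
  | _, None => 0
  end.

(* The number of super edges of stage [l] carrying flow is the same for all
   positive inputs; the maximum is over a constant family. *)
Definition n_used (w : 'I_n) (l : nat) : nat :=
  \max_(y | Z y && in_triangle w y)
    #|[set e : jvertex * jvertex |
        super_edge l e.1 e.2 && (jflow w y e.1 e.2 != 0%R :> R)]|.

Definition johnson_skeleton (w : 'I_n) : skeleton R (vpair n) jvertex := {|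
  sk_root := None;
  sk_label := jlabel w;
  sk_edge := fun u v =>
    [|| super_edge 0 u v, super_edge 1 u v | super_edge 2 u v];
  sk_load := jload w;
  sk_weight := fun u v z a k =>
    let s := jload w u v in
    max_unit_pos_cost Z (in_triangle w) (jloader u) s / (n_used w (stage u))%:R
      * jloader u s z a k;
  sk_flow := jflow w |}.

(* DenseLoad of the pair uv.  The OR plugged at B is over the pairs in
   (N_w \cap B)^2 only, which is known from the loaded pairs: the weight is 0
   on the inputs for which [u] or [v] is not a neighbor of [w]. *)
Definition single_pair (w u v : 'I_n) : lgraph R (vpair n) bool := {|
  lg_root := false;
  lg_label := fun p => if p then pair_set u v else set0;
  lg_edge := fun p q => ~~ p && q;
  lg_weight := fun z a _ _ =>
    if (u \in nbh z w) && (v \in nbh z w)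
    then dense_load R (ch_order ch (pair_set u v)) z a 0 else 0;
  lg_flow := fun y p q => (~~ p && q)%:R |}.

(* G_{w,B}.  There is no pair to load when [u = v], and [w] is never in N_w. *)
Definition plugged (w : 'I_n) (B : {set 'I_n}) :
    lgraph R (vpair n) (option ('I_n * 'I_n * bool)%type) :=
  or_graph Z
    (fun t => [&& t.1 \in B :\ w, t.2 \in B :\ w & t.1 != t.2])
    (fun t z => is_triangle z w t.1 t.2)
    (fun t => single_pair w t.1 t.2)
    (ch_last ch w B).

Definition johnson_graph (w : 'I_n) :=
  plug (expand (johnson_skeleton w))
    (fun B : {set 'I_n} => #|B| == b)
    (fun B => inl (Some B))
    (plugged w)
    (fun B => C1 Z (in_triangle_of w B) (plugged w B)
              / 'C(n - 2, b - 2)%:R).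

Definition triangle_graph :=
  or_graph Z xpredT (@in_triangle n) johnson_graph (ch_apex ch).

End TriangleGraph.

Definition triangle_bound (R : realType) (n m b : nat) (d : R) : R :=
  Num.sqrt (n%:R *
    (b%:R ^+ 2 * (m%:R / n%:R ^+ 2) * ln n%:R
     + n%:R ^+ 2 / b%:R ^+ 2 * (b%:R + b%:R ^+ 2 * d ^+ 2 / n%:R ^+ 2))).

Definition optimal_b (R : realType) (n m : nat) : R :=
  n%:R `^ (4 / 3) / (m%:R * ln n%:R) `^ (1 / 3).

Definition optimal_bound (R : realType) (n m : nat) (d : R) : R :=
  n%:R `^ (5 / 6) * (m%:R * ln n%:R) `^ (1 / 6) + d * Num.sqrt n%:R.

(* The largest d_2 of a negative input. *)
Definition max_d2 (R : realType) (n m : nat) : R :=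
  \big[Num.max/0]_(x | with_edges m x && ~~ @triangle n x) d2 R x.

(* Main.v *)
Require Import Defs.
From mathcomp Require Import all_boot all_order all_algebra.
From mathcomp Require Import reals exp.
From mathcomp Require Import zify ring lra.
Set Implicit Arguments. Unset Strict Implicit. Unset Printing Implicit Defensive.
Import Order.TTheory GRing.Theory Num.Theory.
Local Open Scope ring_scope.

(* Each OR and each plugging divides a positive complexity by its maximum, so
   the whole graph has positive complexity at most 1, and each G_w at most 4,
   one for each of the stages 0, 1, 2 and the final stage.  Everything then
   rests on the negative complexity of G_w on an input x, where the stages cost,
   with N = C(n-2, b-2) and d_w = |N_w|:
   - stage 0, an average over B of b log n (2 |N_w \cap B| + 1), where
     |N_w \cap B| has average d_w b / n;
   - stages 1 and 2, numbers of super edges over N, that is O(n) and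
     n (n - 1) / (b - 1);
   - the final stage, over N, the sum over B of the number of pairs of distinct
     vertices of N_w \cap B; it is at most d_w^2, since a pair belongs to N
     of the subsets B.
   Summing over w turns d_w into 2 m and d_w^2 into n d_2^2, and b >= n^2 / m
   absorbs the lower order terms.  The averages are over C(n, b-2) subsets but
   divided by N only; the ratio is bounded when n - b + 1 >= delta n.  For the
   optimal b this holds because b^2 log n = O(n^2), hence b <= 3 n / 4 + 1 unless n
   is bounded. *)

(** The same N divides the weights of every stage because adding j_1 and then j_2 is injective on
    the (b-2)-subsets avoiding both: each of the stages 0, 1, 2 has exactly N super edges with flow,
    each carrying 1/N, and the plugged graphs are reached at N subsets B, again with flow 1/N each.
    After normalization a super edge costs at most its flow, so a stage costs at most 1. The
    negative side pays for all C(n, b-2) initial subsets, and C(n, b-2) / N = n (n-1) / ((n-b+2)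
    (n-b+1)) is of order n^2 when b is close to n; this is the origin of [delta]. A degenerate case
    shapes many statements: w may lie in no triangle of any graph with m edges. The maxima defining
    C^1 and [n_used] are then 0, so weights may vanish. Composition therefore has to admit zero
    weights as long as no flow uses them, and the negative cost of G_w is estimated only in the
    presence of a positive input [y0]; without one, the factor C^1 of the OR removes G_w
    altogether. *)

Lemma sum_option (W : nmodType) (T : finType) (F : option T -> W) :
  \sum_o F o = F None + \sum_t F (Some t).
Proof.
rewrite (bigD1 None) //= (reindex_omap Some id) => [|[]] //=.
by congr (_ + _); apply: eq_bigl => t; rewrite eqxx.
Qed.

Lemma connect_homo (T T' : finType) (e : rel T) (e' : rel T') (h : T -> T') :
  (forall u v, e u v -> connect e' (h u) (h v)) ->
  forall u v, connect e u v -> connect e' (h u) (h v).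
Proof.
move=> he u v /connectP[p pP ->]; elim: p u pP => [|w p IHp] u //= /andP[euw pP].
exact: connect_trans (he _ _ euw) (IHp _ pP).
Qed.

Lemma connect_rank (T : finType) (e : rel T) (rank : T -> nat) :
  (forall u v, e u v -> rank u < rank v)%N ->
  forall u v, connect e u v -> (rank u <= rank v)%N.
Proof.
move=> er u v /connectP[p pP ->]; elim: p u pP => [|w p IHp] u //= /andP[euw pP].
exact: leq_trans (ltnW (er _ _ euw)) (IHp _ pP).
Qed.

(** * Learning graphs relative to a set of loaded pairs *)

Section FlowGraph.
Variables (R : realType) (I : finType).

(* A learning graph used once the pairs of [D] are loaded.  Unlike in
   [is_learning_graph], [term] says where the flow may stop, and weights are
   compatible on all pairs of inputs, so that the property is preserved when
   [f] is replaced by a disjunction. *)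
Record flow_graph (V : finType) (rank : V -> nat) (D : {set I})
    (Z f : pred (input I)) (term : input I -> V -> Prop) (G : lgraph R I V) :
    Prop := FlowGraph {
  fg_rank : forall u v, lg_edge G u v -> (rank u < rank v)%N;
  fg_rooted : forall u v, lg_edge G u v -> connect (lg_edge G) (lg_root G) u;
  fg_root_label : lg_label G (lg_root G) = set0;
  fg_edge_label : forall u v, lg_edge G u v ->
    lg_label G v = lg_label G u \/
    exists2 j, j \notin lg_label G u & lg_label G v = j |: lg_label G u;
  fg_weight_ge0 : forall z b u v, Z z -> loads G u v ->
    0 <= lg_weight G z b u v;
  fg_weight_local : forall z z' b u v, Z z -> Z z' -> loads G u v ->
    agree (D :|: lg_label G v) z z' ->
    lg_weight G z b u v = lg_weight G z' b u v;
  fg_weight_compat : forall x y u v, Z x -> Z y -> loads G u v ->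
    agree (D :|: lg_label G u) x y -> ~ agree (D :|: lg_label G v) x y ->
    lg_weight G x false u v = lg_weight G y true u v;
  fg_flow_ge0 : forall y u v, Z y -> f y -> 0 <= lg_flow G y u v;
  fg_flow_edge : forall y u v, Z y -> f y ->
    ~~ lg_edge G u v -> lg_flow G y u v = 0;
  fg_flow_weight : forall y u v, Z y -> f y ->
    loads G u v -> lg_weight G y true u v = 0 -> lg_flow G y u v = 0;
  fg_flow_unit : forall y, Z y -> f y -> \sum_v lg_flow G y (lg_root G) v = 1;
  fg_flow_sink : forall y v, Z y -> f y -> v != lg_root G ->
    \sum_u lg_flow G y u v = \sum_u lg_flow G y v u \/
    \sum_u lg_flow G y v u = 0 /\ term y v }.

(** A strictly increasing rank excludes cycles. When x and y differ at the loaded j, they disagree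
    on the label of the target, so compatibility in the stronger sense applies. *)
Lemma flow_graph_learning (V : finType) (rank : V -> nat)
    (Z f : pred (input I)) (G : lgraph R I V) :
  flow_graph rank set0 Z f
    (fun y v => exists2 S : {set I},
       S \subset lg_label G v & certificate Z f y S) G ->
  is_learning_graph Z f G.
Proof.
case=> rk rooted rl el w0 wl wc f0 fe fw fu fs; split => //.
- move=> u v /rk ruv; apply/negP => /(connect_rank rk).
  by rewrite leqNgt ruv.
- move=> z z' b u v Zz Zz' luv a; apply: wl => //.
  by rewrite set0U.
- move=> x y u v j Zx _ Zy _ luv lv a xy; apply: wc => //.
    by rewrite set0U.
  rewrite set0U => /(_ j); rewrite lv setU11 => /(_ isT) /eqP.
  by rewrite (negPf xy).
Qed.

Lemma flow_graph_term (V : finType) (rank : V -> nat) (D : {set I})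
    (Z f : pred (input I)) (term term' : input I -> V -> Prop)
    (G : lgraph R I V) :
  (forall y v, Z y -> f y -> term y v -> term' y v) ->
  flow_graph rank D Z f term G -> flow_graph rank D Z f term' G.
Proof.
move=> tt'; case=> rk rooted rl el w0 wl wc f0 fe fw fu fs; split => // y v Zy fy vr.
by case: (fs y v Zy fy vr) => [|[? /(tt' y v Zy fy)]]; [left|right].
Qed.

Lemma C0_ge0 (V : finType) Z f (G : lgraph R I V) : 0 <= C0 Z f G.
Proof. exact: bigmax_ge_id. Qed.

Lemma C1_ge0 (V : finType) Z f (G : lgraph R I V) : 0 <= C1 Z f G.
Proof. exact: bigmax_ge_id. Qed.

Lemma pos_cost_le_C1 (V : finType) (Z f : pred (input I)) (G : lgraph R I V) y :
  Z y -> f y -> pos_cost G y <= C1 Z f G.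
Proof.
by move=> Zy fy; apply: (le_bigmax_cond _ (fun y => pos_cost G y)); rewrite Zy.
Qed.

Lemma C1_le (V : finType) (Z f : pred (input I)) (G : lgraph R I V) (c : R) :
  0 <= c -> (forall y, Z y -> f y -> pos_cost G y <= c) -> C1 Z f G <= c.
Proof. by move=> c0 h; apply: bigmax_le => // y /andP[]; apply: h. Qed.

Lemma C1_eq0 (V : finType) (Z f : pred (input I)) (G : lgraph R I V) :
  (forall y, Z y -> ~~ f y) -> C1 Z f G = 0.
Proof.
by move=> h; apply: big_pred0 => y; apply/negP => /andP[/h/negPf->].
Qed.

Section Theory.
Variables (V : finType) (rank : V -> nat) (D : {set I}) (Z f : pred (input I)).
Variables (term : input I -> V -> Prop) (G : lgraph R I V).
Hypothesis GP : flow_graph rank D Z f term G.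

Lemma neg_cost_ge0 x : Z x -> 0 <= neg_cost G x.
Proof. by move=> Zx; do 2!apply: sumr_ge0 => ? ?; apply: (fg_weight_ge0 GP). Qed.

Lemma pos_cost_ge0 y : Z y -> 0 <= pos_cost G y.
Proof.
move=> Zy; do 2!apply: sumr_ge0 => ? ?.
by rewrite mulr_ge0 ?sqr_ge0 // invr_ge0; apply: (fg_weight_ge0 GP).
Qed.

(* Hence weights multiplied by [C1] still satisfy [fg_flow_weight], even if
   [C1] is 0. *)
Lemma C1_eq0_flow y u v : Z y -> f y -> loads G u v -> C1 Z f G = 0 ->
  lg_flow G y u v = 0.
Proof.
move=> Zy fy luv C10.
have p0 : pos_cost G y = 0.
  by apply/eqP; rewrite eq_le pos_cost_ge0 // -C10 pos_cost_le_C1.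
have t0 u' v' : loads G u' v' ->
    0 <= lg_flow G y u' v' ^+ 2 / lg_weight G y true u' v'.
  by move=> l; rewrite mulr_ge0 ?sqr_ge0 // invr_ge0; apply: (fg_weight_ge0 GP).
move/eqP: p0; rewrite psumr_eq0; last by move=> u' _; apply: sumr_ge0 => v'; apply: t0.
move=> /allP /(_ u (mem_index_enum _)) /=; rewrite psumr_eq0; last by move=> v'; apply: t0.
move=> /allP /(_ v (mem_index_enum _)) /=; rewrite luv mulf_eq0 sqrf_eq0 invr_eq0.
by case/orP=> /eqP // /(fg_flow_weight GP); apply.
Qed.

(** The source of such an edge would be reachable from the root, hence of rank at least that of the
    root, while the edge makes its rank smaller. *)
Lemma edge_root u : ~~ lg_edge G u (lg_root G).
Proof.
apply/negP => e; have := connect_rank (fg_rank GP) (fg_rooted GP e).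
by rewrite leqNgt (fg_rank GP e).
Qed.

Lemma flow_root y : Z y -> f y -> \sum_u lg_flow G y u (lg_root G) = 0.
Proof.
move=> Zy fy; apply: big1 => u _; apply: (fg_flow_edge GP) => //.
exact: edge_root.
Qed.

Lemma flow_sinkless y v : Z y -> f y -> (forall u, ~~ lg_edge G v u) ->
  \sum_u lg_flow G y v u = 0.
Proof. by move=> Zy fy nv; apply: big1 => u _; apply: (fg_flow_edge GP). Qed.

End Theory.

(** * OR *)

Section Or.
Variables (V T : finType) (Z F : pred (input I)) (P : pred T).
Variables (f : T -> pred (input I)) (G : T -> lgraph R I V) (sel : input I -> T).
Variables (rank : T -> V -> nat) (D : {set I}).
Variables (term : T -> input I -> V -> Prop).

Local Notation orG := (or_graph Z P f G sel).

(** The successor makes the empty transition from the new root strictly increasing. *)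
Definition or_rank (p : option (T * V)) : nat :=
  if p is Some (t, v) then (rank t v).+1 else 0%N.

Definition or_term (y : input I) (p : option (T * V)) : Prop :=
  if p is Some (t, v) then [/\ P t, f t y & term t y v] else False.

Hypothesis GP : forall t, P t -> flow_graph (rank t) D Z (f t) (term t) (G t).
Hypothesis selP : forall y, Z y -> F y -> P (sel y) && f (sel y) y.

Lemma loads_or p q : loads orG p q ->
  if p is Some (t, u) then
    if q is Some (t', v) then [/\ P t, t = t' & loads (G t) u v] else False
  else False.
Proof.
case: p => [[t u]|]; case: q => [[t' v]|] //=; rewrite /loads /=.
  by case/andP=> /and3P[Pt /eqP<- e] l; split => //; rewrite e.
by case/andP=> /andP[Pt /eqP->]; rewrite (fg_root_label (GP Pt)) eqxx.
Qed.

Lemma loads_or_Some t u t' v :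
  loads orG (Some (t, u)) (Some (t', v)) = [&& P t, t == t' & loads (G t) u v].
Proof.
rewrite /loads /=; case: (P t) => //=.
by case: (eqVneq t t') => //= <-.
Qed.

Lemma or_edge_sum (Φ : option (T * V) -> option (T * V) -> R) :
  \sum_p \sum_(q | loads orG p q) Φ p q =
  \sum_(t | P t) \sum_u \sum_(v | loads (G t) u v) Φ (Some (t, u)) (Some (t, v)).
Proof.
rewrite sum_option [X in X + _]big1 => [|p /loads_or] //; rewrite add0r.
have E p : \sum_(q | loads orG (Some p) q) Φ (Some p) q =
    \sum_q if loads orG (Some p) (Some q) then Φ (Some p) (Some q) else 0.
  rewrite big_mkcond sum_option; case: ifP => [/loads_or|]; last by rewrite add0r.
  by case: p.
rewrite (eq_bigr _ (fun p _ => E p)).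
transitivity (\sum_t \sum_u \sum_t' \sum_v
   if loads orG (Some (t, u)) (Some (t', v)) then Φ (Some (t, u)) (Some (t', v)) else 0).
  rewrite [RHS]pair_bigA; apply: eq_bigr => -[t u] _ /=.
  by rewrite pair_bigA; apply: eq_bigr => -[].
rewrite [RHS]big_mkcond; apply: eq_bigr => t _.
case: ifPn => Pt; last first.
  by do 3!apply: big1 => ? _; rewrite loads_or_Some (negPf Pt).
apply: eq_bigr => u _; rewrite (bigD1 t) //= [X in _ + X]big1 ?addr0 => [|t' /negPf tt'].
  rewrite [RHS]big_mkcond; apply: eq_bigr => v _.
  by rewrite loads_or_Some Pt eqxx.
by apply: big1 => v _; rewrite loads_or_Some [t == _]eq_sym tt' andbF.
Qed.

Lemma neg_cost_or x :
  neg_cost orG x = \sum_(t | P t) C1 Z (f t) (G t) * neg_cost (G t) x.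
Proof.
rewrite /neg_cost or_edge_sum; apply: eq_bigr => t _.
rewrite mulr_sumr; apply: eq_bigr => u _.
by rewrite mulr_sumr; apply: eq_bigr => v _.
Qed.

Lemma C1_or_le1 : C1 Z F orG <= 1.
Proof.
apply: C1_le => // y Zy Fy; have /andP[Ps fs] := selP Zy Fy.
rewrite /pos_cost or_edge_sum (bigD1 (sel y)) //= [X in _ + X]big1; last first.
  move=> t /andP[_ /negPf ts]; do 2!apply: big1 => ? _.
  by rewrite ts andbF expr0n mul0r.
have E : \sum_u \sum_(v | loads (G (sel y)) u v)
    (if (sel y == sel y) && (sel y == sel y)
       then lg_flow (G (sel y)) y u v else 0) ^+ 2 /
    (C1 Z (f (sel y)) (G (sel y)) * lg_weight (G (sel y)) y true u v) =
  (C1 Z (f (sel y)) (G (sel y)))^-1 * pos_cost (G (sel y)) y.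
  rewrite mulr_sumr; apply: eq_bigr => u _; rewrite mulr_sumr; apply: eq_bigr => v _.
  by rewrite eqxx /= invfM mulrCA.
rewrite {}E addr0.
(* If the maximum is 0, its inverse is 0 by convention and so is the whole cost. *)
have [->|C1n0] := eqVneq (C1 Z (f (sel y)) (G (sel y))) 0.
  by rewrite invr0 mul0r.
rewrite mulrC ler_pdivrMr ?mul1r ?pos_cost_le_C1 //.
by rewrite lt0r C1n0 C1_ge0.
Qed.

Lemma or_flow_graph : flow_graph or_rank D Z F or_term orG.
Proof.
split.
- move=> [[t u]|] [[t' v]|] //= /and3P[Pt /eqP<- e].
  by rewrite ltnS (fg_rank (GP Pt) e).
- move=> [[t u]|] [[t' v]|] //=.
  case/and3P=> Pt _ e.
  have h := fg_rooted (GP Pt) e.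
  apply: (connect_trans (y := Some (t, lg_root (G t)))).
    by apply: connect1; rewrite /= Pt eqxx.
  apply: (connect_homo (h := fun u => Some (t, u))) h => u' v' /= e'.
  by apply: connect1; rewrite /= Pt eqxx.
- by [].
- move=> [[t u]|] [[t' v]|] //=.
    by case/and3P=> Pt /eqP<- e; apply: (fg_edge_label (GP Pt)).
  by case/andP=> Pt /eqP->; rewrite (fg_root_label (GP Pt)); left.
- move=> z b [[t u]|] [[t' v]|] Zz /loads_or //= [Pt _ l].
  by rewrite mulr_ge0 ?C1_ge0 // (fg_weight_ge0 (GP Pt)).
- move=> z z' b [[t u]|] [[t' v]|] Zz Zz' /loads_or //= [Pt <- l] a.
  by rewrite (fg_weight_local (GP Pt) _ Zz Zz' l a).
- move=> x y [[t u]|] [[t' v]|] Zx Zy /loads_or //= [Pt <- l] a na.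
  by rewrite (fg_weight_compat (GP Pt) Zx Zy l a na).
- move=> y p q Zy Fy; have /andP[Ps fs] := selP Zy Fy.
  case: p q => [[t u]|] [[t' v]|] //=.
  by case: eqP => //= _; case: eqP => // ->; apply: (fg_flow_ge0 (GP Ps)).
- move=> y p q Zy Fy; have /andP[Ps fs] := selP Zy Fy.
  case: p q => [[t u]|] [[t' v]|] //=; last first.
    by case: (eqVneq t' (sel y)) => [->|] //=; rewrite Ps /= => /negPf->.
  case: (eqVneq t t') => //= _; case: (eqVneq t (sel y)) => // ->.
  by rewrite Ps /=; apply: (fg_flow_edge (GP Ps)).
- move=> y p q Zy Fy; have /andP[Ps fs] := selP Zy Fy.
  case: p q => [[t u]|] [[t' v]|] /loads_or //= [Pt <- l].
  (* The weight vanishes either because the factor [C1] is 0, and then no loading edge of the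
     component carries flow, or because it already vanished in the component. *)
  rewrite eqxx /=; case: eqP => // E /eqP; rewrite mulf_eq0 => /orP[] /eqP.
    by apply: (C1_eq0_flow (GP Pt)) => //; rewrite E.
  by apply: (fg_flow_weight (GP Pt)) => //; rewrite E.
- move=> y Zy Fy; rewrite sum_option /= add0r.
  rewrite (bigD1 (sel y, lg_root (G (sel y)))) //= !eqxx big1 ?addr0 // => -[t v] /=.
  by rewrite xpair_eqE; case: eqP => //= -> /negPf->.
- move=> y [[t v]|] // Zy Fy _; have /andP[Ps fs] := selP Zy Fy.
  have outE : \sum_q lg_flow orG y (Some (t, v)) q =
      if t == sel y then \sum_u lg_flow (G t) y v u else 0.
    rewrite sum_option /= add0r.
    transitivity (\sum_t' \sum_u
      if (t == t') && (t == sel y) then lg_flow (G t) y v u else 0).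
      by rewrite pair_bigA; apply: eq_bigr => -[].
    case: ifP => _; last by do 2!apply: big1 => ? _; rewrite andbF.
    rewrite (bigD1 t) //= eqxx /= [X in _ + X]big1 ?addr0 // => t'.
    by rewrite eq_sym => /negPf->; apply: big1.
  have inE : \sum_q lg_flow orG y q (Some (t, v)) =
      if t == sel y then (v == lg_root (G t))%:R + \sum_u lg_flow (G t) y u v else 0.
    rewrite sum_option /=.
    have -> : \sum_(i : T * V) (let (t0, u) := i in
        if (t0 == t) && (t0 == sel y) then lg_flow (G t0) y u v else 0) =
        \sum_t' \sum_u
      if (t' == t) && (t' == sel y) then lg_flow (G t') y u v else 0.
      by rewrite pair_bigA; apply: eq_bigr => -[].
    case: ifP => ts; last first.
      rewrite add0r; apply: big1 => t' _; apply: big1 => u _.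
      by case: eqP => //= ->; rewrite ts.
    congr (_ + _); rewrite (bigD1 t) //= eqxx /= ts.
    by rewrite [X in _ + X]big1 ?addr0 // => t' /negPf->; apply: big1.
  rewrite outE inE; case: eqP => [E|]; last by left.
  move: Ps fs; rewrite -E => Pt ft.
  (* The root of the selected component is no longer a root: it receives one unit through the empty
     transition and passes it on. *)
  have [->|vr] := eqVneq v (lg_root (G t)); rewrite /= ?add0r.
    by left; rewrite (flow_root (GP Pt)) // (fg_flow_unit (GP Pt)) // addr0.
  by case: (fg_flow_sink (GP Pt) Zy ft vr) => [|[]]; [left|right].
Qed.

End Or.
End FlowGraph.

(** * Plugging *)

Section Plug.
Variables (R : realType) (I V V' T : finType) (Z f : pred (input I)).
Variables (P : pred T) (h : T -> pred (input I)).
Variables (J : lgraph R I V) (pt : T -> V) (H : T -> lgraph R I V') (c : T -> R).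
Variables (rankJ : V -> nat) (rankH : T -> V' -> nat).
Variable (term : T -> input I -> V' -> Prop).

Local Notation plugG := (plug J P pt H c).

(** The successor accounts for the empty transition from [pt t] to the root of [H t]. *)
Definition plug_rank (p : V + T * V') : nat :=
  match p with
  | inl v => rankJ v
  | inr (t, v) => (rankJ (pt t) + rankH t v).+1
  end.

Definition plug_term (y : input I) (p : V + T * V') : Prop :=
  if p is inr (t, v) then h t y /\ term t y v else False.

Hypothesis JP : flow_graph rankJ set0 Z f
  (fun y v => exists2 t, P t && h t y & v = pt t) J.
Hypothesis HP : forall t, P t ->
  flow_graph (rankH t) (lg_label J (pt t)) Z (h t) (term t) (H t).
Hypothesis pt_inj : {in P &, injective pt}.
Hypothesis pt_sink : forall t u, P t -> ~~ lg_edge J (pt t) u.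
Hypothesis pt_reach : forall t, P t -> connect (lg_edge J) (lg_root J) (pt t).
Hypothesis pt_root : forall t, P t -> pt t != lg_root J.
Hypothesis c_ge0 : forall t, 0 <= c t.
Hypothesis c_eq0 : forall t, P t -> c t = 0 -> C1 Z (h t) (H t) = 0.

Local Notation inflow y t := (\sum_u lg_flow J y u (pt t)).

(** No edge leaves [pt t], so a nonzero inflow cannot be conserved there: the flow of [J] stops at
    [pt t], and its termination predicate provides [h t y]. Conditions on the flow of [H t], which
    hold only on positive inputs of [h t], are thus available wherever flow arrives. *)
Lemma inflow_neq0 y t : Z y -> f y -> P t -> inflow y t != 0 -> h t y.
Proof.
move=> Zy fy Pt i0; have out0 := flow_sinkless JP Zy fy (fun u => pt_sink u Pt).
case: (fg_flow_sink JP Zy fy (pt_root Pt)) => [E|[_ [t' /andP[Pt' ht']]]].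
  by rewrite E out0 eqxx in i0.
by move/(pt_inj Pt Pt') => ->.
Qed.

Lemma inflow_ge0 y t : Z y -> f y -> 0 <= inflow y t.
Proof. by move=> Zy fy; apply: sumr_ge0 => u _; apply: (fg_flow_ge0 JP). Qed.

Lemma loads_plug p q : loads plugG p q ->
  match p, q with
  | inl u, inl v => is_true (loads J u v)
  | inr (t, u), inr (t', v) => [/\ P t, t = t' & loads (H t) u v]
  | _, _ => False
  end.
Proof.
case: p q => [u|[t u]] [v|[t' v]] //=; rewrite /loads /=.
  case/andP=> /and3P[Pt /eqP-> /eqP->].
  by rewrite (fg_root_label (HP Pt)) setU0 eqxx.
case/andP=> /and3P[Pt /eqP<- ->] l; split => //=.
by apply: contraNneq l => ->.
Qed.

(** Only an inequality: an edge of [H t] loading an element already in the label of [pt t] becomes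
    an empty transition after plugging and drops out of the sum. *)
Lemma plug_edge_sum (Φ : V + T * V' -> V + T * V' -> R) :
  (forall t u v, P t -> loads (H t) u v -> 0 <= Φ (inr (t, u)) (inr (t, v))) ->
  \sum_p \sum_(q | loads plugG p q) Φ p q <=
  \sum_u \sum_(v | loads J u v) Φ (inl u) (inl v) +
  \sum_(t | P t) \sum_u \sum_(v | loads (H t) u v) Φ (inr (t, u)) (inr (t, v)).
Proof.
move=> Φ0; rewrite big_sumType /=; apply: lerD.
  apply: ler_sum => u _; rewrite big_sumType /= [X in _ + X]big1 ?addr0.
    by rewrite le_eqVlt; apply/orP; left; apply/eqP; apply: eq_bigl.
  by move=> q /loads_plug; case: q.
rewrite [X in _ <= X]big_mkcond /=.
have -> : \sum_(tu : T * V') \sum_(q | loads plugG (inr tu) q) Φ (inr tu) q =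
    \sum_t \sum_u \sum_(q | loads plugG (inr (t, u)) q) Φ (inr (t, u)) q.
  by rewrite [RHS]pair_bigA; apply: eq_bigr => -[].
apply: ler_sum => t _; case: ifPn => Pt; last first.
  rewrite big1 // => u _; apply: big1 => q /loads_plug.
  by case: q => [//|[t' v]] [Pt' _ _]; rewrite Pt' in Pt.
apply: ler_sum => u _; rewrite big_sumType /= big1 ?add0r; last by move=> v /loads_plug.
rewrite [X in X <= _]big_mkcond /= [X in _ <= X]big_mkcond /=.
have -> : \sum_(q : T * V')
    (if loads plugG (inr (t, u)) (inr q) then Φ (inr (t, u)) (inr q) else 0) =
    \sum_t' \sum_v (if loads plugG (inr (t, u)) (inr (t', v))
                    then Φ (inr (t, u)) (inr (t', v)) else 0).
  by rewrite [RHS]pair_bigA; apply: eq_bigr => -[].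
rewrite (bigD1 t) //= [X in _ + X]big1 ?addr0.
  apply: ler_sum => v _; case: ifP => [/loads_plug [_ _ ->] //|_].
  by case: ifP => // /(Φ0 _ _ _ Pt).
move=> t' tt'; apply: big1 => v _; case: ifP => // /loads_plug [_ E].
by rewrite E eqxx in tt'.
Qed.

Lemma neg_cost_plug x : Z x ->
  neg_cost plugG x <= neg_cost J x + \sum_(t | P t) c t * neg_cost (H t) x.
Proof.
move=> Zx; apply: (le_trans (plug_edge_sum _)).
  by move=> t u v Pt l /=; rewrite mulr_ge0 // (fg_weight_ge0 (HP Pt)).
rewrite lerD2l; apply: ler_sum => t _; rewrite mulr_sumr.
by apply: ler_sum => u _; rewrite mulr_sumr.
Qed.

Lemma pos_cost_plug y : Z y -> f y ->
  pos_cost plugG y <=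
  pos_cost J y + \sum_(t | P t) inflow y t ^+ 2 / c t * C1 Z (h t) (H t).
Proof.
move=> Zy fy; apply: (le_trans (plug_edge_sum _)).
  move=> t u v Pt l /=; rewrite mulr_ge0 ?sqr_ge0 // invr_ge0 mulr_ge0 //.
  exact: (fg_weight_ge0 (HP Pt)).
rewrite lerD2l; apply: ler_sum => t Pt.
have -> : \sum_u \sum_(v | loads (H t) u v)
    lg_flow plugG y (inr (t, u)) (inr (t, v)) ^+ 2 /
    lg_weight plugG y true (inr (t, u)) (inr (t, v)) =
    inflow y t ^+ 2 / c t * pos_cost (H t) y.
  rewrite mulr_sumr; apply: eq_bigr => u _; rewrite mulr_sumr; apply: eq_bigr => v _.
  by rewrite /= Pt eqxx exprMn invfM mulrACA.
(* [C1] bounds the cost of [H t] on positive inputs of [h t] only; where that may fail, the inflow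
   is 0. *)
have [->|i0] := eqVneq (inflow y t) 0; first by rewrite expr0n !mul0r.
apply: ler_wpM2l; first by rewrite mulr_ge0 ?sqr_ge0 // invr_ge0.
by apply: pos_cost_le_C1 => //; apply: inflow_neq0 i0.
Qed.

Lemma plug_out_inl y u : Z y -> f y ->
  \sum_q lg_flow plugG y (inl u) q =
  \sum_v lg_flow J y u v + \sum_(t | P t && (u == pt t)) inflow y t.
Proof.
move=> Zy fy; rewrite big_sumType /=; congr (_ + _).
transitivity (\sum_t \sum_v if [&& P t, u == pt t & v == lg_root (H t)]
  then inflow y t else 0).
  by rewrite [RHS]pair_bigA; apply: eq_bigr => -[].
rewrite [RHS]big_mkcond; apply: eq_bigr => t _.
rewrite (bigD1 (lg_root (H t))) //= eqxx andbT [X in _ + X]big1 ?addr0 // => v /negPf->.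
by rewrite !andbF.
Qed.

Lemma plug_out_inr y t v : Z y -> f y -> P t ->
  \sum_q lg_flow plugG y (inr (t, v)) q =
  inflow y t * \sum_u lg_flow (H t) y v u.
Proof.
move=> Zy fy Pt; rewrite big_sumType /= big1 // add0r.
transitivity (\sum_t' \sum_u if P t && (t == t')
  then inflow y t * lg_flow (H t) y v u else 0).
  by rewrite [RHS]pair_bigA; apply: eq_bigr => -[].
rewrite (bigD1 t) //= Pt eqxx /= -mulr_sumr [X in _ + X]big1 ?addr0 // => t'.
by rewrite eq_sym => /negPf->; apply: big1.
Qed.

Lemma plug_in_inr y t v : Z y -> f y -> P t ->
  \sum_q lg_flow plugG y q (inr (t, v)) =
  inflow y t * ((v == lg_root (H t))%:R + \sum_u lg_flow (H t) y u v).
Proof.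
move=> Zy fy Pt; rewrite big_sumType /= mulrDr; congr (_ + _).
  rewrite (bigD1 (pt t)) //= Pt eqxx /= [X in _ + X]big1 ?addr0 => [|u /negPf->] //.
  by case: eqP; rewrite ?mulr1 ?mulr0.
transitivity (\sum_t' \sum_u if P t' && (t' == t)
  then inflow y t' * lg_flow (H t') y u v else 0).
  by rewrite [RHS]pair_bigA; apply: eq_bigr => -[].
rewrite (bigD1 t) //= Pt eqxx /= -mulr_sumr [X in _ + X]big1 ?addr0 // => t'.
by move=> /negPf->; apply: big1 => ? _; rewrite andbF.
Qed.

Lemma plug_flow_graph : flow_graph plug_rank set0 Z f plug_term plugG.
Proof.
have connJ u v : connect (lg_edge J) u v -> connect (lg_edge plugG) (inl u) (inl v).
  by apply: (@connect_homo _ _ _ _ inl) => u' v' e; apply: connect1.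
split.
- move=> [u|[t u]] [v|[t' v]] //=; first exact: (fg_rank JP).
    by case/and3P=> _ /eqP-> _; rewrite ltnS leq_addr.
  by case/and3P=> Pt /eqP<- e; rewrite ltnS ltn_add2l (fg_rank (HP Pt)).
- move=> [u|[t u]] [v|[t' v]] // e.
  + exact: connJ (fg_rooted JP e).
  + by move: e => /= /and3P[Pt /eqP-> _]; apply/connJ/pt_reach.
  move: e => /= /and3P[Pt _ e].
  apply: connect_trans (connJ _ _ (pt_reach Pt)) _.
  apply: (connect_trans (y := inr (t, lg_root (H t)))).
    by apply: connect1; rewrite /= Pt !eqxx.
  apply: (@connect_homo _ _ _ _ (fun u => inr (t, u))) (fg_rooted (HP Pt) e).
  by move=> u' v' e'; apply: connect1; rewrite /= Pt eqxx.
- exact: (fg_root_label JP).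
- move=> [u|[t u]] [v|[t' v]] //=; first exact: (fg_edge_label JP).
    case/and3P=> Pt /eqP-> /eqP->; left.
    by rewrite (fg_root_label (HP Pt)) setU0.
  case/and3P=> Pt /eqP<- e; case: (fg_edge_label (HP Pt) e) => [->|[j jN ->]].
    by left.
  (* An element loaded before reaching [pt t] is not loaded twice: the edge turns into an empty
     transition. *)
  have [jpt|jpt] := boolP (j \in lg_label J (pt t)).
    by left; rewrite setUCA (setUidPr _) // sub1set inE jpt.
  by right; exists j; rewrite ?inE ?(negPf jpt) // setUCA.
- move=> z b p q Zz /loads_plug; case: p q => [u|[t u]] [v|[t' v]] //=.
    exact: (fg_weight_ge0 JP).
  by case=> Pt _ l; rewrite mulr_ge0 // (fg_weight_ge0 (HP Pt)).
- move=> z z' b p q Zz Zz' /loads_plug; case: p q => [u|[t u]] [v|[t' v]] //=.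
    exact: (fg_weight_local JP).
  by case=> Pt <- l; rewrite set0U => a; rewrite (fg_weight_local (HP Pt) b Zz Zz' l).
- move=> x y p q Zx Zy /loads_plug; case: p q => [u|[t u]] [v|[t' v]] //=.
    exact: (fg_weight_compat JP).
  case=> Pt <- l; rewrite !set0U => a na.
  by rewrite (fg_weight_compat (HP Pt) Zx Zy l).
- move=> y [u|[t u]] [v|[t' v]] Zy fy //=; first exact: (fg_flow_ge0 JP).
    by case: ifP => // _; apply: inflow_ge0.
  case: ifP => // /andP[Pt _]; have [->|i0] := eqVneq (inflow y t) 0.
    by rewrite mul0r.
  rewrite mulr_ge0 ?inflow_ge0 // (fg_flow_ge0 (HP Pt)) //.
  exact: inflow_neq0 i0.
- move=> y [u|[t u]] [v|[t' v]] Zy fy //=; first exact: (fg_flow_edge JP).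
    by move/negPf->.
  case: ifP => // /andP[Pt ->]; rewrite Pt /= => ne.
  have [->|i0] := eqVneq (inflow y t) 0; first by rewrite mul0r.
  by rewrite (fg_flow_edge (HP Pt)) ?mulr0 //; apply: inflow_neq0 i0.
- move=> y p q Zy fy /loads_plug; case: p q => [u|[t u]] [v|[t' v]] //=.
    exact: (fg_flow_weight JP).
  case=> Pt <- l; rewrite Pt eqxx /= => /eqP; rewrite mulf_eq0.
  have [->|i0] := eqVneq (inflow y t) 0; first by rewrite mul0r.
  have hy := inflow_neq0 Zy fy Pt i0.
  case/orP=> /eqP w0.
    by rewrite (C1_eq0_flow (HP Pt)) ?mulr0 // c_eq0.
  by rewrite (fg_flow_weight (HP Pt)) ?mulr0.
- move=> y Zy fy; rewrite plug_out_inl // (fg_flow_unit JP) // big1 ?addr0 //.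
  by move=> t /andP[Pt]; rewrite eq_sym (negPf (pt_root Pt)).
- move=> y [v|[t v]] Zy fy vr.
    have {}vr : v != lg_root J by apply: contraNneq vr => ->.
    left; rewrite plug_out_inl // big_sumType /= [X in _ + X]big1 ?addr0; last by case.
    (* A plugging point was a sink of [J]. Its inflow is now sent into [H t], and for one [t] only
       since [pt] is injective on [P]. Every other vertex of [J] conserves flow as before. *)
    have [t /andP[Pt /eqP E]|noP] := pickP (fun t => P t && (v == pt t)).
      rewrite E (flow_sinkless JP) // => [|u]; last exact: pt_sink.
      rewrite add0r (bigD1 t) ?Pt ?eqxx //= [X in _ + X]big1 ?addr0 // => t'.
      by case/andP=> /andP[Pt' /eqP /(pt_inj Pt Pt')->]; rewrite eqxx.
    rewrite [X in _ + X]big_pred0 // addr0.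
    case: (fg_flow_sink JP Zy fy vr) => // -[_ [t /andP[Pt _] E]].
    by move: (noP t); rewrite Pt E eqxx.
  (* Vertices of an unplugged [H t] are isolated, with zero flow in and out. *)
  have [Pt|nPt] := boolP (P t); last first.
    left; transitivity (0 : R); [|symmetry]; apply: big1 => -[u|[t' u]] _ //=.
    + by rewrite (negPf nPt).
    + by case: (eqVneq t' t) => [->|?]; rewrite ?andbF // (negPf nPt).
    + by rewrite (negPf nPt).
  rewrite plug_in_inr // plug_out_inr //.
  have [->|i0] := eqVneq (inflow y t) 0; first by rewrite !mul0r; left.
  have hy := inflow_neq0 Zy fy Pt i0.
  have [->|vr'] := eqVneq v (lg_root (H t)).
    by left; rewrite (flow_root (HP Pt)) // (fg_flow_unit (HP Pt)) // addr0.
  rewrite add0r; case: (fg_flow_sink (HP Pt) Zy hy vr') => [->|[-> tt]]; first by left.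
  by right; rewrite mulr0.
Qed.

End Plug.

(** * Expansion of super edges *)

Section Expand.
Variables (R : realType) (I W : finType) (Z f : pred (input I)).
Variables (K : skeleton R I W) (rank : W -> nat) (term : input I -> W -> Prop).

Local Notation edge := (sk_edge K).
Local Notation load := (sk_load K).
Local Notation loaded u v k :=
  (sk_label K u :|: [set i in take k (sk_load K u v)]).

(** The analogue of [flow_graph] before super edges are replaced by paths. The label after k steps
    is [loaded u v k], and the weight conditions are stated position by position, so that they can
    be checked on a loader independently of the path vertices. *)
Record skeleton_graph : Prop := SkeletonGraph {
  sg_rank : forall u v, edge u v -> (rank u < rank v)%N;
  sg_rooted : forall u v, edge u v -> connect edge (sk_root K) u;
  sg_root_label : sk_label K (sk_root K) = set0;
  sg_load_uniq : forall u v, edge u v -> uniq (load u v);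
  sg_load_label : forall u v, edge u v ->
    sk_label K v = sk_label K u :|: [set i in load u v];
  sg_load_new : forall u v i, edge u v -> i \in load u v -> i \notin sk_label K u;
  sg_weight_ge0 : forall z b u v k, Z z -> edge u v -> (k < size (load u v))%N ->
    0 <= sk_weight K u v z b k;
  sg_weight_local : forall z z' b u v k, Z z -> Z z' -> edge u v ->
    (k < size (load u v))%N -> agree (loaded u v k.+1) z z' ->
    sk_weight K u v z b k = sk_weight K u v z' b k;
  sg_weight_compat : forall x y u v k, Z x -> Z y -> edge u v ->
    (k < size (load u v))%N -> agree (loaded u v k) x y ->
    ~ agree (loaded u v k.+1) x y ->
    sk_weight K u v x false k = sk_weight K u v y true k;
  sg_flow_ge0 : forall y u v, Z y -> f y -> 0 <= sk_flow K y u v;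
  sg_flow_edge : forall y u v, Z y -> f y -> ~~ edge u v -> sk_flow K y u v = 0;
  sg_flow_weight : forall y u v k, Z y -> f y -> edge u v ->
    (k < size (load u v))%N -> sk_weight K u v y true k = 0 ->
    sk_flow K y u v = 0;
  sg_flow_unit : forall y, Z y -> f y -> \sum_v sk_flow K y (sk_root K) v = 1;
  sg_flow_sink : forall y v, Z y -> f y -> v != sk_root K ->
    \sum_u sk_flow K y u v = \sum_u sk_flow K y v u \/
    \sum_u sk_flow K y v u = 0 /\ term y v }.

Hypothesis KP : skeleton_graph.

Local Notation xvertex := (W + W * W * 'I_#|I|)%type.
Implicit Types p q : xvertex.

(** A load has no repetition, so the index type ['I_#|I|] has room for all inner vertices of the
    path. *)
Lemma size_load u v : edge u v -> (size (load u v) <= #|I|)%N.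
Proof. by move=> e; rewrite -(card_uniqP (sg_load_uniq KP e)) max_card. Qed.

Lemma expand_edge_label p q : expand_edge K p q ->
  let: (u, v, k) := expand_super p q in
  [/\ edge u v, (k <= (size (load u v)).-1)%N,
      lg_label (expand K) p = loaded u v k &
      lg_label (expand K) q = loaded u v k.+1].
Proof.
case: p q => [u|[[u v] k]] [v'|[[u' v'] k']] //=.
- case/andP=> e s1; split => //; rewrite ?take0 ?take_oversize //.
    by apply/setP => i; rewrite !inE orbF.
  exact: (sg_load_label KP).
- case/and4P=> e /eqP-> /eqP k1 s1; split => //.
    by rewrite take0; apply/setP => i; rewrite !inE orbF.
  by rewrite k1.
- case/and4P=> e /eqP<- k0 /eqP s; split => //; first by rewrite -s.
  by rewrite s take_size; apply: (sg_load_label KP).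
case/and5P=> e /eqP[<- <-] k0 /eqP k's sz; split => //.
  by rewrite -ltnS (ltn_predK sz) -k's ltnW.
by rewrite k's.
Qed.

Lemma loads_expand p q : loads (expand K) p q ->
  let: (u, v, k) := expand_super p q in
  [/\ edge u v, (k < size (load u v))%N,
      lg_label (expand K) p = loaded u v k &
      lg_label (expand K) q = loaded u v k.+1].
Proof.
case/andP=> /expand_edge_label; case: (expand_super p q) => [[u v] k].
case=> e kle -> ->; have [/size0nil->|s0] := posnP (size (load u v)).
  by rewrite eqxx.
by move=> _; split => //; rewrite -(prednK s0) ltnS.
Qed.

(** An inner vertex of a path has a single outgoing edge, and an original vertex has one for each
    super edge leaving it, at position 0. Taking for [Ψ] a flow or a cost gives both flow
    conservation and the complexity of the expanded graph. *)
Lemma expand_out (Ψ : W -> W -> nat -> R) p :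
  \sum_q (if expand_edge K p q
          then let: (u, v, k) := expand_super p q in Ψ u v k else 0) =
  match p with
  | inl u => \sum_(v | edge u v) Ψ u v 0%N
  | inr (u, v, k) =>
      if [&& edge u v, (0 < k)%N & (k < size (load u v))%N] then Ψ u v k else 0
  end.
Proof.
rewrite big_sumType /=; case: p => [u|[[u v] k]] /=.
  have -> : \sum_(q : W * W * 'I_#|I|) (if expand_edge K (inl u) (inr q)
      then let: (u0, v, k) := expand_super (inl u) (inr q) in Ψ u0 v k else 0) =
    \sum_u' \sum_v' \sum_(k < #|I|) (if [&& edge u' v', u == u', k == 1%N :> nat
        & (1 < size (load u' v'))%N] then Ψ u' v' 0%N else 0).
    by rewrite !pair_bigA; apply: eq_bigr => -[[]].
  rewrite [X in _ + X](bigD1 u) //= [X in _ + (_ + X)]big1 ?addr0; last first.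
    by move=> u'; rewrite eq_sym => /negPf->; do 2!apply: big1 => ? _; rewrite andbF.
  rewrite -big_split [RHS]big_mkcond; apply: eq_bigr => v _ /=.
  have [e|ne] /= := boolP (edge u v); last by rewrite big1 ?addr0.
  rewrite eqxx /=; case: leqP => s1.
    by rewrite big1 ?addr0 // => k _; rewrite andbF.
  rewrite (bigD1 (Ordinal (leq_trans s1 (size_load e)))) //= big1 ?addr0 ?add0r //.
  by move=> k; rewrite -val_eqE /= => /negPf->.
have -> : \sum_(q : W * W * 'I_#|I|) (if expand_edge K (inr (u, v, k)) (inr q)
    then let: (u0, v0, k0) := expand_super (inr (u, v, k)) (inr q) in Ψ u0 v0 k0
    else 0) =
  \sum_uv \sum_(k' < #|I|) (if [&& edge u v, (u, v) == uv, (0 < k)%N,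
     k' == k.+1 :> nat & (k' < size (load u v))%N] then Ψ u v k else 0).
  by rewrite !pair_bigA; apply: eq_bigr => -[[]].
rewrite [X in _ + X](bigD1 (u, v)) //= [X in _ + (_ + X)]big1 ?addr0; last first.
  by move=> uv; rewrite eq_sym => /negPf->; apply: big1 => ? _; rewrite andbF.
case: ifPn => [/and3P[e k0 ks]|]; last first.
  rewrite !negb_and => nk; rewrite !big1 ?addr0 // => [k' _|v' _].
    case: ifP => // /and5P[e _ k0 /eqP kk k's]; move: nk; rewrite e k0 /=.
    by rewrite (ltn_trans _ k's) ?kk.
  case: ifP => // /and4P[e _ k0 /eqP ks]; move: nk; rewrite e k0 -ks.
  by rewrite ltnSn.
rewrite e k0 eqxx /=; move: ks; rewrite leq_eqVlt => /orP[/eqP ks|ks].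
  rewrite (bigD1 v) //= -ks !eqxx /= [X in _ + X + _]big1 ?addr0.
    rewrite big1 ?addr0 // => k' _; case: ifP => // /andP[/eqP->].
    by rewrite ltnn.
  by move=> v'; rewrite eq_sym => /negPf->.
rewrite big1 ?add0r => [|v' _]; last by rewrite (ltn_eqF ks) andbF.
rewrite (bigD1 (Ordinal (leq_trans ks (size_load e)))) //= eqxx ks /=.
by rewrite big1 ?addr0 // => k'; rewrite -val_eqE /= => /negPf->.
Qed.

Lemma expand_in (Ψ : W -> W -> R) q :
  \sum_p (if expand_edge K p q
          then let: (u, v, _) := expand_super p q in Ψ u v else 0) =
  match q with
  | inl v => \sum_(u | edge u v) Ψ u v
  | inr (u, v, k) =>
      if [&& edge u v, (0 < k)%N & (k < size (load u v))%N] then Ψ u v else 0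
  end.
Proof.
rewrite big_sumType /=; case: q => [v|[[u v] k]] /=.
  have -> : \sum_(p : W * W * 'I_#|I|) (if expand_edge K (inr p) (inl v)
      then let: (u0, v, k) := expand_super (inr p) (inl v) in Ψ u0 v else 0) =
    \sum_u' \sum_v' \sum_(k < #|I|) (if [&& edge u' v', v' == v, (0 < k)%N
        & (k.+1 == size (load u' v'))%N] then Ψ u' v' else 0).
    by rewrite !pair_bigA; apply: eq_bigr => -[[]].
  rewrite -big_split [RHS]big_mkcond; apply: eq_bigr => u _ /=.
  rewrite [X in _ + X](bigD1 v) //= [X in _ + (_ + X)]big1 ?addr0; last first.
    by move=> u' /negPf->; apply: big1 => ? _; rewrite andbF.
  have [e|ne] /= := boolP (edge u v); last by rewrite big1 ?addr0.
  rewrite eqxx /=; case: leqP => s1.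
    rewrite big1 ?addr0 // => k _; case: ifP => // /andP[k0 /eqP ks].
    by move: s1; rewrite -ks ltnS leqNgt k0.
  have s0 : ((size (load u v)).-1 < #|I|)%N.
    by rewrite prednK ?size_load // ltnW.
  rewrite (bigD1 (Ordinal s0)) //= -ltnS prednK ?(ltnW s1) // s1 eqxx /=.
  rewrite big1 ?addr0 ?add0r // => k; rewrite -val_eqE /= => kn.
  case: ifP => // /andP[_ /eqP ks]; by rewrite -ks eqxx in kn.
have -> : \sum_(p : W * W * 'I_#|I|) (if expand_edge K (inr p) (inr (u, v, k))
    then let: (u0, v0, k0) := expand_super (inr p) (inr (u, v, k)) in Ψ u0 v0
    else 0) =
  \sum_uv \sum_(k' < #|I|) (if [&& edge uv.1 uv.2, uv == (u, v), (0 < k')%N,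
     k == k'.+1 :> nat & (k < size (load uv.1 uv.2))%N] then Ψ uv.1 uv.2 else 0).
  by rewrite !pair_bigA; apply: eq_bigr => -[[]].
rewrite [X in _ + X](bigD1 (u, v)) //= [X in _ + (_ + X)]big1 ?addr0; last first.
  by move=> uv /negPf->; apply: big1 => ? _; rewrite andbF.
case: ifPn => [/and3P[e k0 ks]|]; last first.
  rewrite !negb_and => nk; rewrite !big1 ?addr0 // => [k' _|v' _].
    case: ifP => // /and5P[e _ k0 /eqP kk k's]; move: nk.
    by rewrite e k's kk.
  by case: ifP => // /and4P[e _ /eqP k1 ks]; move: nk; rewrite e k1 ks.
rewrite e ks eqxx /=; have [k1|k1] := eqVneq (k : nat) 1%N.
  rewrite (bigD1 u) //= eqxx -k1 ks /= [X in _ + X + _]big1 ?addr0.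
    rewrite big1 ?addr0 // => k' _; rewrite andbT k1 eqSS.
    by case: (k' : nat).
  by move=> u' /negPf->.
rewrite big1 ?add0r => [|v' _]; last by rewrite andbF.
have s0 : (k.-1 < #|I|)%N by rewrite (leq_ltn_trans (leq_pred _) (ltn_ord k)).
rewrite (bigD1 (Ordinal s0)) //= prednK // eqxx /=.
rewrite -ltnS prednK // ltn_neqAle eq_sym k1 k0 /= big1 ?addr0 // => k'.
rewrite -val_eqE /= => kn; case: ifP => // /and3P[_ /eqP E _].
by rewrite E eqxx in kn.
Qed.

(** Position 0 is the edge leaving the original vertex; the other positions are the edges leaving
    the inner vertices. *)
Lemma sum_load (F : nat -> R) u v : edge u v ->
  \sum_(k < size (load u v)) F k =
  (if (0 < size (load u v))%N then F 0%N else 0) +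
  \sum_(k < #|I| | (0 < k)%N && (k < size (load u v))%N) F k.
Proof.
move=> e; have le := size_load e.
rewrite (big_ord_widen _ F le); case: posnP => s0.
  by rewrite add0r !big_pred0 // => k; rewrite s0 ?andbF.
rewrite (bigD1 (Ordinal (leq_trans s0 le))) //=; congr (_ + _).
by apply: eq_bigl => k; rewrite andbC -val_eqE /= lt0n.
Qed.

Lemma expand_edge_sum (Φ : W -> W -> nat -> R) :
  (forall u v k, edge u v -> (k < size (load u v))%N -> 0 <= Φ u v k) ->
  \sum_p \sum_(q | loads (expand K) p q)
    (let: (u, v, k) := expand_super p q in Φ u v k) <=
  \sum_u \sum_(v | edge u v) \sum_(k < size (load u v)) Φ u v k.
Proof.
(* A super edge with an empty load expands to one empty transition, recorded at position 0 although
   there is nothing to load; [Ψ] gives it the value 0. *)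
move=> Φ0; pose Ψ u v k := if (k < size (load u v))%N then Φ u v k else 0.
apply: (@le_trans _ _ (\sum_p \sum_q (if expand_edge K p q
          then let: (u, v, k) := expand_super p q in Ψ u v k else 0))).
  apply: ler_sum => p _; rewrite big_mkcond; apply: ler_sum => q _.
  case: ifPn => [l|_].
    have := loads_expand l; case/andP: l => /= -> _.
    by case: (expand_super p q) => [[u v] k] [e ks _ _]; rewrite /Ψ ks.
  case: ifP => // /expand_edge_label; case: (expand_super p q) => [[u v] k] [e _ _ _].
  by rewrite /Ψ; case: ifP => // /(Φ0 _ _ _ e).
under eq_bigr => p _ do rewrite expand_out.
rewrite big_sumType /=.
have -> : \sum_(p : W * W * 'I_#|I|) (let (p0, k) := p in let (u, v) := p0 in
      if [&& edge u v, (0 < k)%N & (k < size (load u v))%N] then Ψ u v k else 0) =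
    \sum_u \sum_v \sum_(k < #|I|)
      if [&& edge u v, (0 < k)%N & (k < size (load u v))%N] then Ψ u v k else 0.
  by rewrite !pair_bigA; apply: eq_bigr => -[[]].
rewrite -big_split; apply: ler_sum => u _ /=.
rewrite big_mkcond -big_split [X in _ <= X]big_mkcond; apply: ler_sum => v _ /=.
case: ifPn => [e|_]; last by rewrite add0r big1.
rewrite sum_load // {1}/Ψ lerD2l [X in _ <= X]big_mkcond; apply: ler_sum => k _ /=.
by case: ifP => // /andP[_ ks]; rewrite /Ψ ks.
Qed.

Lemma neg_cost_expand x : Z x ->
  neg_cost (expand K) x <=
  \sum_u \sum_(v | edge u v) \sum_(k < size (load u v)) sk_weight K u v x false k.
Proof. by move=> Zx; apply: expand_edge_sum => u v k; apply: (sg_weight_ge0 KP). Qed.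

Lemma pos_cost_expand y : Z y ->
  pos_cost (expand K) y <=
  \sum_u \sum_(v | edge u v) \sum_(k < size (load u v))
    sk_flow K y u v ^+ 2 / sk_weight K u v y true k.
Proof.
move=> Zy; rewrite -[X in _ <= X]/(\sum_u \sum_(v | edge u v)
  \sum_(k < size (load u v)) (fun u v k => sk_flow K y u v ^+ 2 /
     sk_weight K u v y true k) u v (k : nat)).
apply: le_trans (expand_edge_sum _) => [|u v k e ks].
  apply: ler_sum => p _; apply: ler_sum => q /andP[/= -> _].
  by case: (expand_super p q) => [[u v] k].
by rewrite mulr_ge0 ?sqr_ge0 // invr_ge0 (sg_weight_ge0 KP).
Qed.

(** Lexicographic order on the rank of the source and the position: positions are at most [#|I|],
    hence the factor [#|I|.+1]. *)
Definition expand_rank p : nat :=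
  match p with
  | inl u => (rank u * #|I|.+1)%N
  | inr (u, v, k) => (rank u * #|I|.+1 + k)%N
  end.

Definition expand_term (y : input I) p : Prop :=
  if p is inl u then term y u else False.

Lemma expand_connect u v (k : 'I_#|I|) :
  edge u v -> (0 < k)%N -> (k < size (load u v))%N ->
  connect (expand_edge K) (inl u) (inr (u, v, k)).
Proof.
case: k => k kI /= e; elim: k kI => // k IHk kI _ ks.
have [k0|k0] := posnP k.
  by apply: connect1; move: ks; rewrite /= e eqxx eqSS k0.
apply: connect_trans (IHk (ltnW kI) k0 (ltnW ks)) (connect1 _).
by rewrite /= e !eqxx k0.
Qed.

Lemma expand_connect_super u v : edge u v ->
  connect (expand_edge K) (inl u) (inl v).
Proof.
move=> e; have [s1|s1] := leqP (size (load u v)) 1.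
  by apply: connect1; rewrite /= e.
have s0 : ((size (load u v)).-1 < #|I|)%N.
  by rewrite prednK ?size_load // ltnW.
have k0 : (0 < (size (load u v)).-1)%N by rewrite -ltnS prednK // ltnW.
apply: connect_trans (expand_connect (k := Ordinal s0) e k0 _) (connect1 _) => /=.
  by rewrite prednK // ltnW.
by rewrite e eqxx k0 prednK ?eqxx // ltnW.
Qed.

Lemma expand_flow_graph : flow_graph expand_rank set0 Z f expand_term (expand K).
Proof.
have outflowE y p : \sum_q lg_flow (expand K) y p q =
    match p with
    | inl u => \sum_(v | edge u v) sk_flow K y u v
    | inr (u, v, k) => if [&& edge u v, (0 < k)%N & (k < size (load u v))%N]
                       then sk_flow K y u v else 0
    end.
  by rewrite -(expand_out (fun u v _ => sk_flow K y u v) p).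
have inflowE y q : \sum_p lg_flow (expand K) y p q =
    match q with
    | inl v => \sum_(u | edge u v) sk_flow K y u v
    | inr (u, v, k) => if [&& edge u v, (0 < k)%N & (k < size (load u v))%N]
                       then sk_flow K y u v else 0
    end.
  by rewrite -(expand_in (fun u v => sk_flow K y u v) q).
have out0 y u : Z y -> f y ->
    \sum_(v | edge u v) sk_flow K y u v = \sum_v sk_flow K y u v.
  move=> Zy fy; rewrite big_mkcond; apply: eq_bigr => v _.
  by case: ifPn => // ne; rewrite (sg_flow_edge KP).
have in0 y v : Z y -> f y ->
    \sum_(u | edge u v) sk_flow K y u v = \sum_u sk_flow K y u v.
  move=> Zy fy; rewrite big_mkcond; apply: eq_bigr => u _.
  by case: ifPn => // ne; rewrite (sg_flow_edge KP).
have rk u v k : edge u v -> (k <= #|I|)%N ->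
    (rank u * #|I|.+1 + k < rank v * #|I|.+1)%N.
  move=> e kI; have := sg_rank KP e; rewrite -(leq_pmul2r (ltn0Sn #|I|)).
  by apply: leq_trans; rewrite mulSn addnC ltn_add2r ltnS.
split.
- move=> [u|[[u v] k]] [v'|[[u' v'] k']] //=.
  + by case/andP=> e _; rewrite -[X in (X < _)%N]addn0 rk.
  + by case/and4P=> e /eqP-> /eqP-> _; rewrite addn1.
  + by case/and4P=> e /eqP<- _ _; rewrite rk // ltnW.
  + by case/and5P=> e /eqP[-> ->] _ /eqP-> _; rewrite ltn_add2l.
- have reach u v : edge u v -> connect (expand_edge K) (inl (sk_root K)) (inl u).
    move=> e; apply: (connect_homo (h := inl)) (sg_rooted KP e) => u' v'.
    exact: expand_connect_super.
  move=> [u|[[u v] k]] q; rewrite /lg_edge /lg_root /=.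
    by case: q => [v'|[[u' v'] k']] => [/andP[/reach]|/and4P[/reach e /eqP->]].
  move=> e; have [euv k0 ks] : [/\ edge u v, (0 < k)%N & (k < size (load u v))%N].
    case: q e => [v'|[[u' v'] k']] => [/and4P[-> _ -> /eqP<-] //|].
    by case/and5P=> -> _ -> /eqP kk k's; split => //; rewrite ltnW // -kk.
  exact: connect_trans (reach _ _ euv) (expand_connect euv k0 ks).
- exact: (sg_root_label KP).
- move=> p q e; have := expand_edge_label e.
  case: (expand_super p q) => [[u v] k] [euv _ -> ->].
  have [ks|ks] := ltnP k (size (load u v)); last first.
    by left; rewrite !take_oversize // ltnW.
  have [i0 _] : exists i0 : I, i0 \in load u v.
    by case: (load u v) ks => // i s _; exists i; rewrite mem_head.
  right; exists (nth i0 (load u v) k); last first.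
    rewrite (take_nth i0) //; apply/setP => i.
    by rewrite !inE mem_rcons inE orbCA.
  rewrite !inE negb_or (sg_load_new KP euv) ?mem_nth //=.
  have := sg_load_uniq KP euv; rewrite -{1}(cat_take_drop k (load u v)) cat_uniq.
  rewrite (drop_nth i0) //= => /and3P[_ + _].
  by rewrite negb_or => /andP[].
- move=> z b p q Zz /loads_expand /=.
  case: (expand_super p q) => [[u v] k] [euv ks _ _].
  exact: (sg_weight_ge0 KP).
- move=> z z' b p q Zz Zz' /loads_expand /=.
  case: (expand_super p q) => [[u v] k] [euv ks _ ->].
  by rewrite set0U; apply: (sg_weight_local KP).
- move=> x y p q Zx Zy /loads_expand /=.
  case: (expand_super p q) => [[u v] k] [euv ks -> ->].
  by rewrite !set0U; apply: (sg_weight_compat KP).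
- move=> y p q Zy fy /=; case: ifP => // _.
  by case: (expand_super p q) => [[u v] k]; apply: (sg_flow_ge0 KP).
- by move=> y p q Zy fy /= /negPf->.
- move=> y p q Zy fy /loads_expand /=.
  case: (expand_super p q) => [[u v] k] [euv ks _ _] w0.
  by case: ifP => // _; apply: (sg_flow_weight KP) w0.
- by move=> y Zy fy; rewrite outflowE /= out0 // (sg_flow_unit KP).
- move=> y [v|[[u v] k]] Zy fy vr; rewrite outflowE inflowE; last by left.
  by rewrite out0 // in0 //; apply: (sg_flow_sink KP).
Qed.

End Expand.

(** * Graphs *)

Section Graphs.
Variable n : nat.
Implicit Types (x y z : input (vpair n)) (u v w : 'I_n) (B : {set 'I_n}).

Lemma vpair_exists u v : u != v -> exists e : vpair n, val e = [set u; v].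
Proof.
move=> uv; have c : #|[set u; v]| == 2%N by rewrite cards2 uv.
by exists (Sub [set u; v] c); rewrite SubK.
Qed.

Lemma adj_neq z u v : adj z u v -> u != v.
Proof.
case/existsP=> e /andP[/eqP E _]; apply/negP => /eqP uv.
by have := valP e; rewrite /= E uv setUid cards1.
Qed.

Lemma adj_agree (S : {set vpair n}) z z' u v :
  (forall e : vpair n, val e = [set u; v] -> e \in S) -> agree S z z' ->
  adj z u v = adj z' u v.
Proof.
by move=> uvS a; apply: eq_existsb => e; case: eqP => //= /uvS /a ->.
Qed.

(** The pair determines u once w is known, because a pair has two elements and so u differs from
    w. *)
Lemma mem_star w B (e : vpair n) u : val e = [set w; u] ->
  (e \in star w B) = (u \in B).
Proof.
move=> E; rewrite inE; apply/existsP/idP => [[v /andP[vB /eqP]]|uB]; last first.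
  by exists u; rewrite uB E eqxx.
rewrite E => Ewv; have uw : u != w.
  by apply/negP => /eqP uw; have := valP e; rewrite /= E uw setUid cards1.
have : u \in [set w; v] by rewrite -Ewv !inE eqxx orbT.
by rewrite !inE (negPf uw) => /eqP->.
Qed.

Lemma nbh_agree w B z z' u : agree (star w B) z z' -> u \in B ->
  (u \in nbh z w) = (u \in nbh z' w).
Proof.
by move=> a uB; rewrite !inE; apply: adj_agree a => e E; rewrite (mem_star _ E).
Qed.

Lemma star_subset w B B' : B \subset B' -> star w B \subset star w B'.
Proof.
move=> BB'; apply/subsetP => e; rewrite !inE => /existsP[v /andP[vB E]].
by apply/existsP; exists v; rewrite (subsetP BB').
Qed.

Lemma card_pair_set u v : (#|pair_set u v| <= 1)%N.
Proof.
apply/card_le1P => e; rewrite inE => /eqP E e'; rewrite !inE.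
by apply/eqP/eqP => [E'|->//]; apply: val_inj; rewrite /= E E'.
Qed.

Lemma pair_set1 u v : u != v -> exists e, pair_set u v = [set e].
Proof.
case/vpair_exists=> e E; exists e; apply/setP => e'; rewrite !inE.
by apply/eqP/eqP => [|->//]; rewrite -E => /val_inj.
Qed.

(** The pairs in both stars are among the images of the common vertices u under the map sending u to
    {w, u}. The default [e0] only covers u = w, where this set is not a pair. *)
Lemma card_star_inter w B B' : (#|[set e in star w B | e \in star w B']| <= #|B :&: B'|)%N.
Proof.
have [->|[e0 _]] := set_0Vmem [set e in star w B | e \in star w B'].
  by rewrite cards0.
apply: leq_trans (leq_imset_card (fun u => insubd e0 [set w; u]) _).
apply/subset_leq_card/subsetP => e; rewrite inE => /andP[+ e'].
rewrite inE => /existsP[u /andP[uB /eqP E]].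
apply/imsetP; exists u; first by rewrite inE uB -(mem_star _ E).
by apply: val_inj; rewrite /= val_insubd -E (valP e).
Qed.

Lemma card_star w B : (#|star w B| <= #|B|)%N.
Proof.
have := card_star_inter w B B; rewrite setIid; congr (_ <= _)%N; apply: eq_card => e.
by rewrite !inE andbb.
Qed.

Lemma card_star_nbh x w B : (#|[set e in star w B | x e]| <= #|nbh x w :&: B|)%N.
Proof.
rewrite setIC; apply: leq_trans (card_star_inter w B (nbh x w)).
apply/subset_leq_card/subsetP => e; rewrite inE => /andP[eB xe].
rewrite inE eB /=; move: eB; rewrite inE => /existsP[u /andP[_ /eqP E]].
by rewrite (mem_star _ E) inE; apply/existsP; exists e; rewrite E eqxx.
Qed.

Lemma is_triangleP y w u v : is_triangle y w u v ->
  [/\ u != w, v != w, u != v, u \in nbh y w & v \in nbh y w].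
Proof.
case/and3P=> wu wv uv; split; rewrite ?inE //.
- by rewrite eq_sym (adj_neq wu).
- by rewrite eq_sym (adj_neq wv).
exact: adj_neq uv.
Qed.

Lemma card_draws_sub (B : {set 'I_n}) k :
  #|[set A : {set 'I_n} | (#|A| == k) && (A \subset B)]| = 'C(#|B|, k).
Proof. by rewrite -cards_draws; apply: eq_card => A; rewrite !inE andbC. Qed.

(** Adding [A] is a bijection from the k-subsets of the complement of [A] to the sets counted
    here. *)
Lemma card_draws_sup (A : {set 'I_n}) k :
  #|[set B : {set 'I_n} | (#|B| == k + #|A|)%N && (A \subset B)]|
  = 'C(n - #|A|, k).
Proof.
have -> : (n - #|A|)%N = #|~: A| by rewrite [RHS]cardsCs setCK card_ord.
rewrite -card_draws_sub.
rewrite -[RHS](card_in_imset (f := fun B => B :|: A)) => [|B B']; last first.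
  rewrite !inE => /andP[_ BA] /andP[_ B'A] E; apply/setP => i.
  have [iA|iA] := boolP (i \in A).
    have nX (X : {set 'I_n}) : X \subset ~: A -> (i \in X) = false.
      by move/subsetP/(_ i); rewrite inE iA; case: (i \in X) => // /(_ isT).
    by rewrite (nX _ BA) (nX _ B'A).
  by move/setP: E => /(_ i); rewrite !inE (negPf iA) !orbF.
apply: eq_card => B; rewrite inE; apply/andP/imsetP => [[/eqP cB AB]|[B' + ->]].
  exists (B :\: A); last by rewrite setDE setUIl [~: A :|: A]setUC setUCr setIT (setUidPl AB).
  by rewrite !inE cardsDS // cB addnK eqxx subsetDr.
rewrite inE => /andP[/eqP <- B'A]; rewrite subsetUr; split => //.
by rewrite cardsU disjoint_setI0 ?cards0 ?subn0 // disjoints_subset.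
Qed.

End Graphs.

(** * Orders of loading and the two loaders *)

Section Order.
Variables (n : nat) (ch : choices n).

Lemma mem_order S e : (e \in ch_order ch S) = (e \in S).
Proof. by rewrite (perm_mem (ch_orderP ch S)) mem_enum. Qed.

Lemma order_uniq S : uniq (ch_order ch S).
Proof. by rewrite (perm_uniq (ch_orderP ch S)) enum_uniq. Qed.

Lemma size_order S : size (ch_order ch S) = #|S|.
Proof. by rewrite (perm_size (ch_orderP ch S)) cardE. Qed.

Lemma count_order (z : input (vpair n)) S :
  count z (ch_order ch S) = #|[set e in S | z e]|.
Proof.
rewrite (permP (ch_orderP ch S)) -size_filter cardE /enum_mem -filter_predI.
congr size; apply: eq_filter => e; rewrite /= !inE.
by rewrite andbC.
Qed.

End Order.

Section Loaders.
Variables (R : realType) (I : finType).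

Lemma ln_succ_gt0 l : (0 < l)%N -> 0 < ln l.+1%:R :> R.
Proof. by move=> l0; rewrite ln_gt0 // ltr1n. Qed.

Lemma dense_load_gt0 (s : seq I) z b k : (k < size s)%N -> 0 < dense_load R s z b k.
Proof. by move=> ks; rewrite ltr0n (leq_trans _ ks). Qed.

Lemma sparse_load_gt0 (s : seq I) z b k : (k < size s)%N -> 0 < sparse_load R s z b k.
Proof.
move=> ks; have s0 : (0 < size s)%N by apply: leq_trans ks.
by rewrite /sparse_load; case: ifP => _; rewrite !mulr_gt0 ?ltr0n ?ln_succ_gt0.
Qed.

Lemma take_map_agree (s : seq I) (z z' : input I) k :
  (forall i, i \in take k s -> z i = z' i) ->
  take k [seq z i | i <- s] = take k [seq z' i | i <- s].
Proof. by move=> a; rewrite -!map_take; apply/eq_in_map => i /a. Qed.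

Lemma sparse_load_local (s : seq I) (z z' : input I) b k : (k < size s)%N ->
  (forall i, i \in take k.+1 s -> z i = z' i) ->
  sparse_load R s z b k = sparse_load R s z' b k.
Proof.
move=> ks /take_map_agree E; rewrite /sparse_load.
have -> : nth false [seq z i | i <- s] k = nth false [seq z' i | i <- s] k.
  by rewrite -(nth_take _ (ltnSn k)) E nth_take.
suff -> : take k [seq z i | i <- s] = take k [seq z' i | i <- s] by [].
by rewrite -(take_takel _ (leqnSn k)) E take_takel.
Qed.

(** The two bits at position k differ, so x has 0 there exactly when y has 1: both weights fall in
    the same branch, with the same count of earlier ones. *)
Lemma sparse_load_compat (s : seq I) (x y : input I) k : (k < size s)%N ->
  (forall i, i \in take k s -> x i = y i) ->
  ~ (forall i, i \in take k.+1 s -> x i = y i) ->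
  sparse_load R s x false k = sparse_load R s y true k.
Proof.
move=> ks a na; rewrite /sparse_load (take_map_agree a).
suff -> : (nth false [seq x i | i <- s] k == false) =
          (nth false [seq y i | i <- s] k == true) by [].
have [i0 _] : exists i0 : I, i0 \in s.
  by case: s ks {a na} => // i s _; exists i; rewrite mem_head.
rewrite !(nth_map i0) //; case: (boolP (x (nth i0 s k) == y (nth i0 s k))).
  move/eqP=> E; case: na => i; rewrite (take_nth i0) // mem_rcons inE.
  by case/orP=> [/eqP->|/a].
by case: (x _) (y _) => -[].
Qed.

End Loaders.

(** * The plugged learning graphs *)

Section Plugged.
Variables (R : realType) (n m b : nat) (ch : choices n).
Local Notation Z := (@with_edges n m).
Local Notation single w t := (single_pair R ch w t.1 t.2).
Local Notation plugged_pair w B :=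
  (fun t : 'I_n * 'I_n => [&& t.1 \in B :\ w, t.2 \in B :\ w & t.1 != t.2]).

(** The weight tests whether both ends are neighbors of w. This is not a function of the pair loaded
    here, but it is determined by the star of w on [B], loaded before the plugging; hence [star w B]
    in the role of [D]. *)
Lemma single_flow_graph w (B : {set 'I_n}) (t : 'I_n * 'I_n) :
  plugged_pair w B t ->
  flow_graph (nat_of_bool : bool -> nat) (star w B) Z
    (fun z => is_triangle z w t.1 t.2) (fun _ (p : bool) => p : Prop) (single w t).
Proof.
case: t => u v /= /and3P[/setD1P[uw uB] /setD1P[vw vB] uv].
have [e E] := pair_set1 uv.
split => //=.
- by case=> -[].
- by case=> -[]// _; apply: connect0.
- case=> -[] // _; right; exists e; rewrite ?inE // E.
  by rewrite setU0.
- by move=> z a p q Zz _; case: ifP => // _; rewrite ler0n.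
- move=> z z' a p q _ _ _ ag; have {}ag : agree (star w B) z z'.
    by move=> i iS; apply: ag; rewrite inE iS.
  by rewrite (nbh_agree ag uB) (nbh_agree ag vB).
- move=> x y p q _ _ _ ag _; have {}ag : agree (star w B) x y.
    by move=> i iS; apply: ag; rewrite inE iS.
  by rewrite (nbh_agree ag uB) (nbh_agree ag vB).
- by move=> y p q _ _ /negPf->.
- move=> y p q _ /is_triangleP[_ _ _ -> ->] _ /eqP.
  by rewrite /= /dense_load size_order E cards1 oner_eq0.
- by move=> y _ _; rewrite big_bool /= addr0.
- by move=> y [] // _ _ _; right; rewrite big1.
Qed.

Lemma single_pos_cost w (B : {set 'I_n}) t y : plugged_pair w B t ->
  is_triangle y w t.1 t.2 -> pos_cost (single w t) y <= 1.
Proof.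
case: t => u v /= /and3P[_ _ uv] /is_triangleP[_ _ _ uN vN].
have [e E] := pair_set1 uv.
rewrite /pos_cost !big_bool /= ![\sum_(_ | _) _]big_mkcond !big_bool /= /loads /=.
rewrite uN vN /dense_load size_order E cards1 !add0r.
by rewrite big_mkcond big_bool /= addr0 expr1n divr1; case: ifP.
Qed.

Lemma single_neg_cost w u v x :
  neg_cost (single_pair R ch w u v) x <= ((u \in nbh x w) && (v \in nbh x w))%:R.
Proof.
rewrite /neg_cost !big_bool /= ![\sum_(_ | _) _]big_mkcond !big_bool /= /loads /=.
rewrite !add0r; case: (_ && (v \in _)); last by rewrite big1.
rewrite big_mkcond big_bool /= addr0; case: ifP => // _; rewrite /dense_load size_order.
by rewrite ler_nat card_pair_set.
Qed.

Lemma plugged_selP w B y : in_triangle_of w B y ->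
  plugged_pair w B (ch_last ch w B y) &&
  is_triangle y w (ch_last ch w B y).1 (ch_last ch w B y).2.
Proof.
case/(ch_lastP ch) => uB vB t; rewrite t andbT.
by have [uw vw uv _ _] := is_triangleP t; rewrite !inE uw vw uB vB.
Qed.

Lemma plugged_flow_graph w (B : {set 'I_n}) :
  flow_graph (or_rank (fun _ => nat_of_bool)) (star w B) Z (in_triangle_of w B)
    (or_term (plugged_pair w B) (fun t z => is_triangle z w t.1 t.2)
       (fun _ _ (p : bool) => p : Prop))
    (plugged R m ch w B).
Proof.
apply: or_flow_graph => [t|y _]; first exact: single_flow_graph.
exact: plugged_selP.
Qed.

Lemma plugged_C1_le1 w B : C1 Z (in_triangle_of w B) (plugged R m ch w B) <= 1.
Proof.
apply: (C1_or_le1 (rank := fun _ => nat_of_bool) (D := star w B)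
  (term := fun _ _ (p : bool) => p : Prop)) => [t|y _]; first exact: single_flow_graph.
exact: plugged_selP.
Qed.

Lemma plugged_neg_cost w (B : {set 'I_n}) x : Z x ->
  neg_cost (plugged R m ch w B) x <=
  \sum_(t : 'I_n * 'I_n | t.1 != t.2)
     ((t.1 \in nbh x w :&: B) && (t.2 \in nbh x w :&: B))%:R.
Proof.
move=> Zx; rewrite (neg_cost_or _ (@single_flow_graph w B)).
rewrite big_mkcond [X in _ <= X]big_mkcond; apply: ler_sum => -[u v] _ /=.
case: ifPn => [P|_]; last by case: ifP => // _; rewrite ler0n.
have := P => /and3P[/setD1P[uw uB] /setD1P[vw vB] ->].
have GP := single_flow_graph (t := (u, v)) P.
apply: le_trans (_ : neg_cost (single_pair R ch w u v) x <= _).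
  rewrite -[X in _ <= X]mul1r ler_wpM2r ?(neg_cost_ge0 GP) //.
  apply: C1_le => // y _; exact: (single_pos_cost (t := (u, v)) P).
by apply: le_trans (single_neg_cost _ _ _ _) _; rewrite !inE uB vB !andbT.
Qed.

End Plugged.

(** * The Johnson construction *)

Lemma sum_pred1 (R : pzSemiRingType) (T : finType) (a : bool) (t0 : T) :
  \sum_t (a && (t == t0))%:R = a%:R :> R.
Proof.
rewrite (bigD1 t0) //= eqxx andbT big1 ?addr0 // => t /negPf->.
by rewrite andbF.
Qed.

Section Johnson.
Variables (R : realType) (n m b : nat) (ch : choices n).
Hypothesis hb : (2 <= b <= n)%N.
Local Notation Z := (@with_edges n m).
Local Notation N := 'C(n - 2, b - 2).
Local Notation q := (N%:R^-1 : R).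
Implicit Types (B : {set 'I_n}) (w : 'I_n).

Lemma Johnson_size_gt0 : (0 < N)%N.
Proof. by rewrite bin_gt0; lia. Qed.

Section Flow.
Variables (w : 'I_n) (y : input (vpair n)).
Hypothesis hy : in_triangle w y.
Local Notation j1 := (ch_base ch w y).1.
Local Notation j2 := (ch_base ch w y).2.

Lemma base_triangle : is_triangle y w j1 j2.
Proof. exact: ch_baseP. Qed.

(* The subsets reached by the flow after stage [l]. *)
Definition chain (l : nat) (B : {set 'I_n}) : bool :=
  [&& (#|B| + 2 == b + l)%N, (j1 \in B) == (0 < l)%N & (j2 \in B) == (1 < l)%N].

Definition chain_pred (l : nat) (B : {set 'I_n}) : option {set 'I_n} :=
  if l is 0%N then None else Some (B :\ (if l == 1%N then j1 else j2)).

Let j12 : j1 != j2.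
Proof. by have [] := is_triangleP base_triangle. Qed.

Lemma chain_up1 B : chain 0 B -> chain 1 (j1 |: B).
Proof.
case/and3P=> /eqP cB /eqP j1B /eqP j2B.
rewrite /chain cardsU1 j1B !inE eqxx [j2 == _]eq_sym (negPf j12) j2B /= andbT.
by rewrite -addnA cB addn0 addnC.
Qed.

Lemma chain_up2 B : chain 1 B -> chain 2 (j2 |: B).
Proof.
case/and3P=> /eqP cB /eqP j1B /eqP j2B.
rewrite /chain cardsU1 j2B !inE eqxx j1B orbT /= andbT.
by rewrite -addnA cB addnC -addnA.
Qed.

Lemma chain_down1 B : chain 1 B -> chain 0 (B :\ j1).
Proof.
case/and3P=> cB /eqP j1B /eqP j2B; rewrite /chain !inE eqxx j2B andbF /= andbT.
by move: cB; rewrite (cardsD1 j1 B) j1B -addnA add1n !addn2 addn1 addn0 eqSS.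
Qed.

Lemma chain_down2 B : chain 2 B -> chain 1 (B :\ j2).
Proof.
case/and3P=> cB /eqP j1B /eqP j2B; rewrite /chain !inE eqxx j1B j12 /= andbT.
by move: cB; rewrite (cardsD1 j2 B) j2B -addnA add1n !addn2 addn1 eqSS.
Qed.

(** Adding and removing j_1 are inverse to each other between the two levels. Read from the source
    this gives the outgoing flow, read from the target the incoming flow. *)
Lemma chain_step1 B B' :
  (chain 0 B && (B' == j1 |: B)) = (chain 1 B' && (B == B' :\ j1)).
Proof.
apply/andP/andP => -[c /eqP->]; split => //; rewrite ?chain_up1 ?chain_down1 //.
  by case/and3P: c => _ /eqP j1B _; rewrite setU1K ?j1B.
by case/and3P: c => _ /eqP j1B _; rewrite setD1K ?j1B.
Qed.

Lemma chain_step2 B B' :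
  (chain 1 B && (B' == j2 |: B)) = (chain 2 B' && (B == B' :\ j2)).
Proof.
apply/andP/andP => -[c /eqP->]; split => //; rewrite ?chain_up2 ?chain_down2 //.
  by case/and3P: c => _ _ /eqP j2B; rewrite setU1K ?j2B.
by case/and3P: c => _ _ /eqP j2B; rewrite setD1K ?j2B.
Qed.

Lemma start_setsE B : (B \in start_sets b ch w y) = chain 0 B.
Proof.
rewrite /start_sets /chain; case: (ch_base ch w y) => i1 i2 /=.
by rewrite inE addn0 !eqbF_neg.
Qed.

Lemma card_chain0 : #|[set B | chain 0 B]| = N.
Proof.
have -> : (n - 2)%N = #|~: [set j1; j2]|.
  by rewrite cardsCs setCK card_ord cards2 j12.
rewrite -card_draws_sub; apply: eq_card => B; rewrite !inE /chain addn0 !eqbF_neg.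
have -> : (#|B| + 2 == b)%N = (#|B| == b - 2)%N by apply/eqP/eqP; lia.
congr (_ && _); rewrite subsetC; apply/andP/subsetP => [[h1 h2] i|h].
  by rewrite !inE => /orP[/eqP->|/eqP->].
by split; [have := h j1|have := h j2]; rewrite !inE eqxx ?orbT => ->.
Qed.

Lemma card_chain l : (l <= 2)%N -> #|[set B | chain l B]| = N.
Proof.
have c1 : #|[set B | chain 1 B]| = N.
  rewrite -card_chain0 -[RHS](card_in_imset (f := fun B => j1 |: B)).
    apply: eq_card => B; rewrite inE; apply/idP/imsetP => [c|[B' + ->]].
      exists (B :\ j1); first by rewrite inE chain_down1.
      by case/and3P: c => _ /eqP j1B _; rewrite setD1K ?j1B.
    by rewrite inE; apply: chain_up1.
  move=> B B'; rewrite !inE => /and3P[_ /eqP j1B _] /and3P[_ /eqP j1B' _] E.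
  by rewrite -(setU1K (negbT j1B)) E setU1K ?j1B'.
case: l => [|[|[|//]]] _; [exact: card_chain0|exact: c1|].
rewrite -c1 -[RHS](card_in_imset (f := fun B => j2 |: B)).
  apply: eq_card => B; rewrite inE; apply/idP/imsetP => [c|[B' + ->]].
    exists (B :\ j2); first by rewrite inE chain_down2.
    by case/and3P: c => _ _ /eqP j2B; rewrite setD1K ?j2B.
  by rewrite inE; apply: chain_up2.
move=> B B'; rewrite !inE => /and3P[_ _ /eqP j2B] /and3P[_ _ /eqP j2B'] E.
by rewrite -(setU1K (negbT j2B)) E setU1K ?j2B'.
Qed.

Lemma sum_chain l : (l <= 2)%N -> \sum_(B : {set 'I_n}) (chain l B)%:R = N%:R :> R.
Proof.
move=> l2; rewrite -(card_chain l2) -sum1_card natr_sum [RHS]big_mkcond.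
by apply: eq_bigr => B _; rewrite inE; case: ifP.
Qed.

Lemma card_start_sets : #|start_sets b ch w y| = N.
Proof. by rewrite -card_chain0; apply: eq_card => B; rewrite start_setsE inE. Qed.

Lemma jflow_None u : jflow R b ch w y u None = 0.
Proof. by rewrite /jflow; case: (ch_base ch w y); case: u. Qed.

Lemma jflow_start B : jflow R b ch w y None (Some B) = (chain 0 B)%:R * q.
Proof.
rewrite /jflow; case E: (ch_base ch w y) => [i1 i2].
by rewrite start_setsE card_start_sets; case: ifP; rewrite ?mul1r ?mul0r.
Qed.

Lemma jflow_step B B' : jflow R b ch w y (Some B) (Some B') =
  ((chain 0 B && (B' == j1 |: B))%:R + (chain 1 B && (B' == j2 |: B))%:R) * q.
Proof.
rewrite /jflow; case E: (ch_base ch w y) => [i1 i2].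
have [E1 E2] : i1 = j1 /\ i2 = j2 by rewrite E.
rewrite E1 E2 start_setsE card_start_sets {i1 i2 E E1 E2}.
have -> : [exists B0 in start_sets b ch w y,
    (B == j1 |: B0) && (B' == j2 |: (j1 |: B0))] = chain 1 B && (B' == j2 |: B).
  apply/exists_inP/andP => [[B0]|[c /eqP->]].
    by rewrite start_setsE => /chain_up1 c /andP[/eqP-> /eqP->].
  have j1B : j1 \in B by case/and3P: c => _ /eqP->.
  by exists (B :\ j1); rewrite ?start_setsE ?chain_down1 // setD1K ?eqxx.
have [c0|_] /= := boolP (chain 0 B); last first.
  by rewrite add0r; case: ifP; rewrite ?mul1r ?mul0r.
have -> : chain 1 B = false.
  by apply/negP; move: c0 => /and3P[_ /eqP j1B _] /and3P[_]; rewrite j1B.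
by rewrite /= orbF addr0; case: ifP; rewrite ?mul1r ?mul0r.
Qed.

Lemma jflow_step_in B B' : jflow R b ch w y (Some B) (Some B') =
  ((chain 1 B' && (B == B' :\ j1))%:R + (chain 2 B' && (B == B' :\ j2))%:R) * q.
Proof. by rewrite jflow_step chain_step1 chain_step2. Qed.

Lemma jflow_ge0 u v : 0 <= jflow R b ch w y u v.
Proof.
case: u v => [B|] [B'|]; rewrite ?jflow_None ?jflow_start ?jflow_step //.
  by rewrite mulr_ge0 ?addr_ge0 ?invr_ge0 ?ler0n.
by rewrite mulr_ge0 ?invr_ge0 ?ler0n.
Qed.

Lemma jflow_out_root : \sum_v jflow R b ch w y None v = 1.
Proof.
rewrite sum_option jflow_None add0r.
under eq_bigr => B _ do rewrite jflow_start.
by rewrite -mulr_suml sum_chain // divff // pnatr_eq0 -lt0n Johnson_size_gt0.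
Qed.

Lemma jflow_out B : \sum_v jflow R b ch w y (Some B) v =
  ((chain 0 B)%:R + (chain 1 B)%:R) * q.
Proof.
rewrite sum_option jflow_None add0r.
under eq_bigr => B' _ do rewrite jflow_step.
by rewrite -mulr_suml big_split /= !sum_pred1.
Qed.

Lemma jflow_in B : \sum_u jflow R b ch w y u (Some B) =
  ((chain 0 B)%:R + (chain 1 B)%:R + (chain 2 B)%:R) * q.
Proof.
rewrite sum_option jflow_start.
under eq_bigr => B' _ do rewrite jflow_step_in.
by rewrite -mulr_suml big_split /= !sum_pred1 -addrA [in RHS]mulrDl.
Qed.

(** A subset reached by the flow is reached from one predecessor only, so the super edges of a stage
    that carry flow correspond to their targets. *)
Lemma used_edgesE l : (l <= 2)%N ->
  [set e : option {set 'I_n} * option {set 'I_n} |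
     super_edge b l e.1 e.2 && (jflow R b ch w y e.1 e.2 != 0)]
  = [set (chain_pred l B, Some B) | B in [set B | chain l B]].
Proof.
have q0 : q != 0 by rewrite invr_eq0 pnatr_eq0 -lt0n Johnson_size_gt0.
move=> l2; apply/setP => -[u v]; rewrite inE /=; apply/idP/imsetP => [|[B]].
  case: u v => [B|] [B'|] //=.
    case/andP=> /and3P[l0 /eqP cB _]; rewrite jflow_step_in mulf_eq0 negb_or q0 andbT => f0.
    have [/andP[c1 /eqP EB]|nc1] := boolP (chain 1 B' && (B == B' :\ j1)).
      have /and3P[/eqP cB0 _ _] := chain_down1 c1; rewrite -EB in cB0.
      have -> : l = 1%N by apply: (@addnI b); rewrite -cB -[b in RHS]addn0 -cB0 -addnA.
      by exists B'; rewrite ?inE //= EB.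
    have [/andP[c2 /eqP EB]|nc2] := boolP (chain 2 B' && (B == B' :\ j2)).
      have /and3P[/eqP cB0 _ _] := chain_down2 c2; rewrite -EB in cB0.
      have -> : l = 2%N by apply: (@addnI b); rewrite -cB -[2%N]/(1 + 1)%N addnA -cB0 -addnA.
      by exists B'; rewrite ?inE //= EB.
    by move: f0; rewrite (negPf nc1) (negPf nc2) addr0 eqxx.
  case/andP=> /andP[/eqP-> _]; rewrite jflow_start => f0; exists B' => //.
  by rewrite inE; apply: contraNT f0 => /negPf->; rewrite mul0r.
rewrite inE => c [-> ->] /=; case: l l2 c => [|[|[|//]]] _ c /=.
- rewrite jflow_start c mul1r q0 andbT.
  by case/and3P: c; rewrite addn0.
- rewrite jflow_step_in c eqxx; have := chain_down1 c.
  case/and3P=> /eqP cB _ _; apply/andP; split.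
    apply/andP; split; first by rewrite -[3%N]/(2 + 1)%N addnA cB addn0.
    case/and3P: c => _ /eqP j1B _; apply/existsP; exists j1.
    by rewrite !inE eqxx /= setD1K ?j1B.
  by rewrite mulf_neq0 // -natrD pnatr_eq0.
rewrite jflow_step_in c eqxx; have := chain_down2 c.
case/and3P=> /eqP cB _ _; apply/andP; split.
  apply/andP; split; first by rewrite -[3%N]/(2 + 1)%N addnA cB -addnA.
  case/and3P: c => _ _ /eqP j2B; apply/existsP; exists j2.
  by rewrite !inE eqxx /= setD1K ?j2B.
by rewrite mulf_neq0 // -natrD pnatr_eq0 addn1.
Qed.

Lemma card_used_edges l : (l <= 2)%N ->
  #|[set e : option {set 'I_n} * option {set 'I_n} |
     super_edge b l e.1 e.2 && (jflow R b ch w y e.1 e.2 != 0)]| = N.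
Proof.
by move=> l2; rewrite used_edgesE // card_imset ?card_chain // => B B' [].
Qed.

(** Levels 0 and 1 are disjoint, as they differ on the membership of j_1; the two terms of the flow
    are never both present. *)
Lemma jflow_neq0 u v : jflow R b ch w y u v != 0 -> jflow R b ch w y u v = q.
Proof.
case: u v => [B|] [B'|]; rewrite ?jflow_None ?jflow_start ?jflow_step ?eqxx //.
  have [/andP[/and3P[_ /eqP j1B _] _]|_] := boolP (chain 0 B && (B' == j1 |: B)).
    by rewrite /chain j1B /= andbF addr0 mul1r.
  by rewrite add0r; case: (chain 1 B && _); rewrite ?mul1r ?mul0r ?eqxx.
by case: (chain 0 B'); rewrite ?mul1r ?mul0r ?eqxx.
Qed.

End Flow.

(** The count is N on each positive input, and y witnesses that the maximum is not over an empty
    family, where it would be 0. *)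
Lemma n_usedE w l y : Z y -> in_triangle w y -> (l <= 2)%N ->
  n_used R m b ch w l = N.
Proof.
move=> Zy hy l2; apply/eqP; rewrite eqn_leq; apply/andP; split.
  by apply/bigmax_leqP => y' /andP[_ hy']; rewrite card_used_edges.
by rewrite -(card_used_edges hy l2); apply: (leq_bigmax_cond y); rewrite Zy.
Qed.

End Johnson.

(** * The learning graph G_w: flow and positive complexity *)

Section JohnsonGraph.
Variables (R : realType) (n m b : nat) (ch : choices n) (w : 'I_n).
Hypothesis hb : (2 <= b <= n)%N.
Local Notation Z := (@with_edges n m).
Local Notation N := 'C(n - 2, b - 2).
Local Notation q := (N%:R^-1 : R).
Local Notation K := (johnson_skeleton R m b ch w).
Local Notation c1 u s := (max_unit_pos_cost Z (in_triangle w) (jloader R u) s).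
Implicit Types (B : {set 'I_n}) (u v : option {set 'I_n}).

Lemma Johnson_size_neq0 : N%:R != 0 :> R.
Proof. by rewrite pnatr_eq0 -lt0n Johnson_size_gt0. Qed.

Lemma edge_Some B v : sk_edge K (Some B) v ->
  [/\ (#|B| + 3 == b + 1)%N || (#|B| + 3 == b + 2)%N &
      exists2 j, j \notin B & v = Some (j |: B)].
Proof.
case: v => [B'|] //=; rewrite -andb_orl => /andP[-> /existsP[j]].
by rewrite inE => /andP[jB /eqP->]; split => //; exists j.
Qed.

Lemma edge_None v : sk_edge K None v ->
  exists2 B : {set 'I_n}, (#|B| + 2 == b)%N & v = Some B.
Proof. by case: v => [B|] //=; rewrite !orbF => cB; exists B. Qed.

(** Edges are defined by a disjunction over the stages, whereas weights read the stage off the size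
    of the source; the two agree. *)
Lemma stage_edge u v : sk_edge K u v -> (stage b u <= 2)%N /\
  super_edge b (stage b u) u v.
Proof.
case: u => [B|] e; last by case: (edge_None e) => B cB -> /=; rewrite cB.
have [/orP cB [j jB ->]] := edge_Some e.
have st : stage b (Some B) = 1%N \/ stage b (Some B) = 2%N.
  by rewrite /stage; case: cB => /eqP->; rewrite addnC addnK; [left|right].
split; first by case: st => ->.
have cB' : (#|B| + 3 == b + stage b (Some B))%N.
  by rewrite /stage subnKC //; case: cB => /eqP->; rewrite leq_addr.
rewrite /= in cB' *; rewrite cB'; apply/andP; split; first by case: st => /= ->.
by apply/existsP; exists j; rewrite inE jB eqxx.
Qed.

Lemma edge_label u v : sk_edge K u v -> jlabel w u \subset jlabel w v.
Proof.
case: u => [B /edge_Some[_ [j _ ->]]|_]; last by rewrite sub0set.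
by apply: star_subset; rewrite subsetUr.
Qed.

Lemma jloader_gt0 u (s : seq (vpair n)) z a k : (k < size s)%N ->
  0 < jloader R u s z a k.
Proof. by case: u => [B|]; [apply: dense_load_gt0|apply: sparse_load_gt0]. Qed.

Lemma max_unit_pos_cost_ge0 u s : 0 <= c1 u s.
Proof. exact: bigmax_ge_id. Qed.

Lemma unit_pos_cost_le u s y : Z y -> in_triangle w y ->
  unit_pos_cost (jloader R u) s y <= c1 u s.
Proof.
move=> Zy hy; apply: (le_bigmax_cond _ (fun y => unit_pos_cost (jloader R u) s y)).
by rewrite Zy.
Qed.

Lemma max_unit_pos_cost_gt0 u s y : Z y -> in_triangle w y -> (0 < size s)%N -> 0 < c1 u s.
Proof.
move=> Zy hy s0; apply: lt_le_trans (unit_pos_cost_le u s Zy hy).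
rewrite /unit_pos_cost (bigD1 (Ordinal s0)) //= ltr_wpDr //.
  by apply: sumr_ge0 => k _; rewrite invr_ge0 ltW // jloader_gt0.
by rewrite invr_gt0 jloader_gt0.
Qed.

Lemma jflow_edge y u v : in_triangle w y -> ~~ sk_edge K u v ->
  jflow R b ch w y u v = 0.
Proof.
move=> hy; apply: contraNeq => f0.
suff [l l2 /andP[e _]] : exists2 l, (l <= 2)%N &
    super_edge b l u v && (jflow R b ch w y u v != 0).
  case: l l2 e => [|[|[|//]]] _ /= e; rewrite /sk_edge /= e ?orbT //.
have used l B : (l <= 2)%N -> chain b ch w y l B ->
    super_edge b l (chain_pred ch w y l B) (Some B) &&
    (jflow R b ch w y (chain_pred ch w y l B) (Some B) != 0).
  move=> l2 c; have : (chain_pred ch w y l B, Some B) \in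
     [set (chain_pred ch w y l B, Some B) | B in [set B | chain b ch w y l B]].
    by apply/imsetP; exists B; rewrite ?inE.
  by rewrite -(used_edgesE R ch hb hy) // inE.
case: v f0 => [B|]; last by rewrite jflow_None eqxx.
case: u => [B'|] f0.
  rewrite jflow_step_in // mulf_eq0 negb_or in f0; case/andP: f0 => f0 _.
  have [/andP[c /eqP E]|nc1] := boolP (chain b ch w y 1 B && (B' == B :\ (ch_base ch w y).1)).
    by exists 1%N => //; rewrite E; apply: (used 1%N B isT c).
  have [/andP[c /eqP E]|nc2] := boolP (chain b ch w y 2 B && (B' == B :\ (ch_base ch w y).2)).
    by exists 2%N => //; rewrite E; apply: (used 2%N B isT c).
  by move: f0; rewrite (negPf nc1) (negPf nc2) addr0 eqxx.
rewrite jflow_start // mulf_eq0 negb_or in f0; case/andP: f0 => f0 _.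
exists 0%N => //; apply: (used 0%N B) => //.
by apply: contraNT f0 => /negPf->.
Qed.

Lemma johnson_weightE u v z a k : sk_weight K u v z a k =
  c1 u (jload ch w u v) / (n_used R m b ch w (stage b u))%:R
  * jloader R u (jload ch w u v) z a k.
Proof. by []. Qed.

Definition johnson_rank u : nat := if u is Some B then #|B|.+1 else 0%N.

Definition johnson_term (y : input (vpair n)) u : Prop :=
  exists2 B : {set 'I_n}, (#|B| == b) && in_triangle_of w B y & u = Some B.

(** Removing elements one at a time leads back to a subset of size b-2, which the root reaches
    directly. As b is at least 2, there is always an element to remove. *)
Lemma connect_johnson B : (#|B| + 2 == b)%N || (#|B| + 1 == b)%N || (#|B| == b) ->
  connect (sk_edge K) None (Some B).
Proof.
have conn0 B' : (#|B'| + 2 == b)%N -> connect (sk_edge K) None (Some B').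
  by move=> cB; apply: connect1; rewrite /= cB.
have up l B' : (0 < #|B'|)%N -> (l == 1%N) || (l == 2%N) ->
    (#|B'| + 2 == b + l)%N ->
    (forall j, j \in B' -> connect (sk_edge K) None (Some (B' :\ j))) ->
    connect (sk_edge K) None (Some B').
  case/card_gt0P=> j jB l12 cB c; apply: connect_trans (c j jB) (connect1 _).
  have e : [&& (0 < l)%N, (#|B' :\ j| + 3 == b + l)%N &
      [exists j0 in ~: (B' :\ j), B' == j0 |: (B' :\ j)]].
    have -> : (0 < l)%N by case/orP: l12 => /eqP->.
    rewrite -(eqP cB) (cardsD1 j B') jB [(true + _)%N]addnC -addnA eqxx /=.
    by apply/existsP; exists j; rewrite !inE eqxx setD1K ?eqxx.
  by case/orP: l12 => /eqP El; rewrite El /= in e; rewrite /sk_edge /= e ?orbT.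
have conn1 B' : (#|B'| + 1 == b)%N -> connect (sk_edge K) None (Some B').
  move=> cB; apply: (up 1%N) => //.
  - by move: cB hb; lia.
  - by rewrite -(eqP cB) -addnA.
  move=> j jB; apply: conn0; rewrite -(eqP cB) (cardsD1 j B') jB.
  by rewrite -addnA add1n !addn2 addn1.
case/orP=> [/orP[/conn0|/conn1] //|cB]; apply: (up 2%N) => //.
- by move: cB hb; lia.
- by rewrite (eqP cB).
by move=> j jB; apply: conn1; rewrite -(eqP cB) (cardsD1 j B) jB addnC.
Qed.

Lemma johnson_skeleton_graph :
  skeleton_graph Z (in_triangle w) K johnson_rank johnson_term.
Proof.
have mem_load u v i : i \in sk_load K u v = (i \in jlabel w v :\: jlabel w u).
  exact: mem_order.
split.
- move=> [B|] v; last by case/edge_None=> B _ ->.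
  by case/edge_Some=> _ [j jB ->] /=; rewrite cardsU1 jB.
- move=> [B|] v e; last exact: connect0.
  have [cB _] := edge_Some e; apply: connect_johnson.
  by case/orP: cB => cB; apply/orP; left; apply/orP; [left|right]; move: cB; lia.
- by [].
- by move=> u v _; apply: order_uniq.
- move=> u v /edge_label uv; apply/setP => i; rewrite !inE mem_load !inE.
  by move/subsetP: uv => /(_ i); case: (i \in jlabel w u) => // /(_ isT)->.
- by move=> u v i _; rewrite mem_load => /setDP[].
- move=> z a u v k _ _ ks; rewrite johnson_weightE.
  by apply: mulr_ge0; [rewrite mulr_ge0 ?max_unit_pos_cost_ge0 ?invr_ge0|apply/ltW/jloader_gt0].
- move=> z z' a u v k _ _ _ ks ag; rewrite !johnson_weightE; congr (_ * _).
  case: u ks ag => [B|] // ks ag; apply: sparse_load_local => // i it.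
  by apply: ag; rewrite !inE it orbT.
- move=> x y u v k _ _ _ ks ag nag; rewrite !johnson_weightE; congr (_ * _).
  case: u ks ag nag => [B|] // ks ag nag; apply: sparse_load_compat => // [i it|al].
    by apply: ag; rewrite !inE it orbT.
  by apply: nag => i; rewrite !inE /= => /al.
- by move=> y u v _ hy; apply: jflow_ge0.
- by move=> y u v _ hy; apply: jflow_edge.
(* The input y is itself positive, so the maximal cost c^1 of a nonempty super edge and [n_used] are
   both positive here. *)
- move=> y u v k Zy hy e ks; rewrite johnson_weightE => /eqP; apply: contraTeq => f0.
  have [l2 st] := stage_edge e.
  rewrite (n_usedE R ch hb Zy hy l2) mulf_neq0 ?gt_eqF ?jloader_gt0 //.
  by rewrite divr_gt0 ?ltr0n ?Johnson_size_gt0 ?(max_unit_pos_cost_gt0 _ Zy hy) // (leq_trans _ ks).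
- by move=> y _ hy; apply: jflow_out_root.
- move=> y [B|] // _ hy _; rewrite /sk_flow /= jflow_in // jflow_out //.
  (* The flow stops at level 2 only. Such a [B] has size b and contains j_1 and j_2, which complete
     w to a triangle. *)
  have [c2|_] := boolP (chain b ch w y 2 B); last by left; rewrite addr0.
  have /and3P[cB /eqP j1B /eqP j2B] := c2.
  right; rewrite /chain j1B j2B !andbF addr0 mul0r; split => //.
  exists B => //; rewrite addn2 addn2 !eqSS in cB; rewrite cB.
  apply/exists_inP; exists (ch_base ch w y).1 => //.
  by apply/exists_inP; exists (ch_base ch w y).2 => //; apply: ch_baseP.
Qed.

Lemma expand_inflow y v : Z y -> in_triangle w y ->
  \sum_p lg_flow (expand K) y p (inl v) = \sum_u jflow R b ch w y u v.
Proof.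
move=> Zy hy; rewrite -[LHS]/(\sum_p (if expand_edge K p (inl v) then
  let: (u, v, _) := expand_super p (inl v) in jflow R b ch w y u v else 0)).
rewrite (expand_in johnson_skeleton_graph (jflow R b ch w y) (inl v)).
rewrite big_mkcond; apply: eq_bigr => u _; case: ifPn => // ne.
by rewrite jflow_edge.
Qed.

Local Notation cB := (fun B : {set 'I_n} =>
  C1 Z (in_triangle_of w B) (plugged R m ch w B) / N%:R).

Lemma plug_factor_ge0 B : 0 <= cB B.
Proof. by rewrite divr_ge0 ?C1_ge0. Qed.

Lemma johnson_expand_flow_graph :
  flow_graph (expand_rank johnson_rank) set0 Z (in_triangle w)
    (fun y p => exists2 B : {set 'I_n}, (#|B| == b) && in_triangle_of w B y
                                        & p = inl (Some B)) (expand K).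
Proof.
apply: flow_graph_term (expand_flow_graph johnson_skeleton_graph).
by move=> y [u|] //= Zy hy [B hB ->]; exists B.
Qed.

Section Plugging.

Let pt_inj : {in (fun B : {set 'I_n} => #|B| == b) &, injective
  (fun B => inl (Some B) : option {set 'I_n} + option {set 'I_n} * option {set 'I_n} * 'I_#|vpair n|)}.
Proof. by move=> B B' _ _ []. Qed.

Let pt_sink B p : #|B| == b -> ~~ lg_edge (expand K) (inl (Some B)) p.
Proof.
move=> cB; apply/negP => e.
have [v /edge_Some[+ _]] : exists v, sk_edge K (Some B) v.
  by case: p e => [v|[[u v] k]] /= => [/andP[]|/and4P[e /eqP E _ _]]; exists v => //; subst u.
by rewrite (eqP cB) !eqn_add2l.
Qed.

Let pt_reach B : #|B| == b ->
  connect (lg_edge (expand K)) (lg_root (expand K)) (inl (Some B)).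
Proof.
move=> cB; apply: (@connect_homo _ _ (sk_edge K) _ inl _ None (Some B)).
  by move=> u v; apply: (expand_connect_super johnson_skeleton_graph).
by apply: connect_johnson; rewrite cB orbT.
Qed.

Let plug_factor_eq0 B : #|B| == b -> cB B = 0 ->
  C1 Z (in_triangle_of w B) (plugged R m ch w B) = 0.
Proof.
move=> _ /eqP; rewrite mulf_eq0 invr_eq0 (negPf Johnson_size_neq0) orbF.
by move/eqP.
Qed.

Lemma johnson_flow_graph :
  flow_graph (plug_rank (fun B => inl (Some B)) (expand_rank johnson_rank)
      (fun _ => or_rank (fun _ => nat_of_bool))) set0 Z (in_triangle w)
    (plug_term (in_triangle_of w)
       (fun B => or_term (fun t => [&& t.1 \in B :\ w, t.2 \in B :\ w & t.1 != t.2])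
          (fun t z => is_triangle z w t.1 t.2) (fun _ _ (p : bool) => p : Prop)))
    (johnson_graph R m b ch w).
Proof.
apply: plug_flow_graph => //; first exact: johnson_expand_flow_graph.
- by move=> B _; apply: plugged_flow_graph.
- exact: plug_factor_ge0.
Qed.

Lemma johnson_pos_cost y : Z y -> in_triangle w y ->
  pos_cost (johnson_graph R m b ch w) y <= 4.
Proof.
move=> Zy hy.
apply: le_trans (pos_cost_plug johnson_expand_flow_graph
  (fun B _ => plugged_flow_graph R m ch w B) pt_inj pt_sink _ plug_factor_ge0 Zy hy) _ => //.
have -> : 4 = 3 + 1 :> R by rewrite -natr1.
apply: lerD.
  apply: le_trans (pos_cost_expand johnson_skeleton_graph Zy) _.
  (* With flow 1/N and weights multiplied by c^1/N, a super edge costs (1/N) times its unit cost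
     over c^1, which is at most its flow. One unit of flow enters each of the three levels, hence
     the total 3. *)
  apply: (@le_trans _ _ (\sum_u \sum_v jflow R b ch w y u v)).
    apply: ler_sum => u _; rewrite big_mkcond; apply: ler_sum => v _.
    case: ifPn => [e|_]; last exact: jflow_ge0.
    have [l2 _] := stage_edge e.
    have [f0|f0] := eqVneq (jflow R b ch w y u v) 0.
      by rewrite /= f0 big1 // => k _; rewrite expr0n mul0r.
    have fq := jflow_neq0 hb hy f0.
    rewrite /= (n_usedE R ch hb Zy hy l2) fq.
    set s := jload ch w u v; rewrite (eq_bigr (fun k : 'I_(size s) =>
      q / c1 u s * (jloader R u s y true k)^-1)); last first.
      move=> k _; rewrite !invfM invrK expr2 -!mulrA; congr (_ * _).
      by rewrite mulrCA [X in _ * X]mulrA mulVf ?Johnson_size_neq0 // mul1r.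
    rewrite -mulr_sumr; have [c0|c0] := eqVneq (c1 u s) 0.
      by rewrite c0 invr0 mulr0 mul0r invr_ge0.
    rewrite -mulrA ler_piMr ?invr_ge0 // mulrC ler_pdivrMr ?mul1r.
      exact: unit_pos_cost_le.
    by rewrite lt0r c0 max_unit_pos_cost_ge0.
  rewrite exchange_big sum_option /= big1 ?add0r => [|u _]; last first.
    by rewrite jflow_None.
  under eq_bigr => B _ do rewrite jflow_in //.
  rewrite -mulr_suml !big_split /= !sum_chain //.
  by rewrite !mulrDl !mulfV ?Johnson_size_neq0 // -[1 : R]/(1%:R) -!natrD.
(* A subset of size b can only be at level 2, so its inflow is 1/N or 0. With the factor C/N, an
   inflow 1/N gives (1/N)^2 (N/C) C = 1/N when C is nonzero, and 0 otherwise. *)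
have H B : #|B| == b -> (\sum_p lg_flow (expand K) y p (inl (Some B))) ^+ 2 / cB B *
    C1 Z (in_triangle_of w B) (plugged R m ch w B) <= (chain b ch w y 2 B)%:R * q.
  move=> cB'; rewrite expand_inflow // jflow_in //.
  have cn l : l != 2%N -> chain b ch w y l B = false.
    by move=> l2; rewrite /chain (eqP cB') eqn_add2l eq_sym (negPf l2).
  rewrite (cn 0%N) // (cn 1%N) //= !add0r; case: (chain b ch w y 2 B); last first.
    by rewrite !mul0r expr0n /= !mul0r.
  rewrite !mul1r; set C := C1 _ _ _; have [->|C0] := eqVneq C 0.
    by rewrite mulr0 invr_ge0.
  rewrite invfM invrK expr2 -!mulrA [C^-1 * _]mulrCA mulVf // mulr1 mulVf ?Johnson_size_neq0 //.
  by rewrite mulr1.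
apply: (@le_trans _ _ (\sum_B (chain b ch w y 2 B)%:R * q)).
  rewrite big_mkcond; apply: ler_sum => B _; case: ifPn => [/H //|_].
  by rewrite mulr_ge0 ?invr_ge0.
by rewrite -mulr_suml sum_chain // mulfV ?Johnson_size_neq0.
Qed.

Lemma johnson_C1 : C1 Z (in_triangle w) (johnson_graph R m b ch w) <= 4.
Proof. by apply: C1_le => // y; apply: johnson_pos_cost. Qed.

Lemma neg_cost_johnson x : Z x ->
  neg_cost (johnson_graph R m b ch w) x <=
  \sum_u \sum_(v | sk_edge K u v) \sum_(k < size (jload ch w u v))
     sk_weight K u v x false k +
  \sum_(B : {set 'I_n} | #|B| == b) q * neg_cost (plugged R m ch w B) x.
Proof.
move=> Zx; have H := neg_cost_plug (J := expand K) (pt := fun B => inl (Some B))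
  (P := fun B : {set 'I_n} => #|B| == b)
  (fun B _ => plugged_flow_graph R m ch w B) plug_factor_ge0 Zx.
apply: le_trans H _.
apply: lerD; first exact: (neg_cost_expand johnson_skeleton_graph Zx).
apply: ler_sum => B _; apply: ler_wpM2r.
  exact: (neg_cost_ge0 (plugged_flow_graph R m ch w B) Zx).
by rewrite -[X in _ <= X]mul1r ler_wpM2r ?invr_ge0 // plugged_C1_le1.
Qed.

End Plugging.
End JohnsonGraph.

(** * Counting *)

Section Counting.
Variable n : nat.
Implicit Types (S B : {set 'I_n}).

Lemma sum_set_mem S B : (\sum_(u in S) (u \in B) = #|S :&: B|)%N.
Proof.
rewrite -sum1_card [RHS]big_mkcond [LHS]big_mkcond /=; apply: eq_bigr => u _.
by rewrite inE; case: (u \in S) (u \in B) => -[].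
Qed.

(** Double counting: an element belongs to C(n-1, k-1) of the k-subsets, and n C(n-1, k-1) = k C(n,
    k). The factor n keeps the identity free of division. *)
Lemma sum_card_draws_inter S k :
  (n * \sum_(B : {set 'I_n} | #|B| == k) #|S :&: B| = #|S| * (k * 'C(n, k)))%N.
Proof.
under eq_bigr => B _ do rewrite -sum_set_mem.
rewrite exchange_big /=.
(* For k = 0 the truncated k-1 would give the binomial 1 instead of 0. *)
have [k0|k0] := posnP k.
  rewrite k0 mul0n muln0 big1 ?muln0 // => u _; apply: big1 => B.
  by rewrite cards_eq0 => /eqP->; rewrite inE.
have E u : (\sum_(B : {set 'I_n} | #|B| == k) (u \in B) = 'C(n.-1, k.-1))%N.
  have -> : (n.-1 = n - #|[set u]|)%N by rewrite cards1 subn1.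
  rewrite -card_draws_sup cards1 addn1 (prednK k0) -sum1_card [RHS]big_mkcond.
  rewrite [LHS]big_mkcond /=; apply: eq_bigr => B _; rewrite inE sub1set.
  by case: (_ == _); case: (_ \in _).
under eq_bigr => u _ do rewrite E.
rewrite sum_nat_const mulnCA mul_bin_diag prednK //.
Qed.

Lemma sum_card_draws_pairs S k : (2 <= k)%N ->
  (\sum_(B : {set 'I_n} | #|B| == k) \sum_(t : 'I_n * 'I_n | t.1 != t.2)
     ((t.1 \in S :&: B) && (t.2 \in S :&: B)) <= #|S| ^ 2 * 'C(n - 2, k - 2))%N.
Proof.
move=> k2; rewrite exchange_big /=.
have E (t : 'I_n * 'I_n) : t.1 != t.2 ->
    (\sum_(B : {set 'I_n} | #|B| == k) ((t.1 \in S :&: B) && (t.2 \in S :&: B))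
     = ((t.1 \in S) && (t.2 \in S)) * 'C(n - 2, k - 2))%N.
  move=> t12; have c2 : #|[set t.1; t.2]| = 2%N by rewrite cards2 t12.
  rewrite -c2 -card_draws_sup c2 subnK // -sum1_card big_distrr /=.
  rewrite [LHS]big_mkcond [RHS]big_mkcond /=; apply: eq_bigr => B _.
  rewrite !inE subUset !sub1set muln1.
  by case: (_ == _); case: (_ \in S); case: (_ \in S); case: (_ \in B); case: (_ \in B).
rewrite (eq_bigr _ E) -big_distrl /= leq_mul2r; apply/orP; right.
rewrite -mulnn -cardsX -sum1_card [X in (_ <= X)%N]big_mkcond.
rewrite [X in (X <= _)%N]big_mkcond /=; apply: leq_sum => -[u v] _ /=.
by rewrite !inE /=; case: (_ != _); case: (_ && _).
Qed.

(** Handshake: an edge {a, c} is counted only at the ordered pairs (a, c) and (c, a). *)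
Lemma sum_card_nbh (x : input (vpair n)) :
  (\sum_w #|nbh x w| <= 2 * #|[set e | x e]|)%N.
Proof.
have E w : (#|nbh x w| <= \sum_u \sum_(e | x e) (val e == [set w; u]))%N.
  rewrite -sum1_card big_mkcond; apply: leq_sum => u _; rewrite inE.
  case: ifP => // /existsP[e /andP[E xe]].
  by rewrite (bigD1 e) //= E.
apply: (leq_trans (leq_sum _ (fun w _ => E w))).
rewrite pair_bigA exchange_big /= mulnC -sum1_card big_distrl /=.
rewrite [X in (_ <= X)%N](eq_bigl x) => [|e]; last by rewrite inE.
apply: leq_sum => e xe; rewrite mul1n.
have /cards2P[a [c [ac Ee]]] := valP e.
rewrite /= in Ee.
apply: (@leq_trans #|[set (a, c); (c, a)]|); last by rewrite cards2; case: (_ != _).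
rewrite -sum1_card [X in (_ <= X)%N]big_mkcond; apply: leq_sum => -[w u] _ /=.
case: eqP => //; rewrite Ee => E'.
have wu : w != u.
  by apply/negP => /eqP wu; move: (cards2 a c); rewrite E' wu setUid cards1 ac.
have wS : w \in [set a; c] by rewrite E' set21.
have uS : u \in [set a; c] by rewrite E' set22.
suff -> : (w, u) \in [set (a, c); (c, a)] by [].
move: wS uS wu; rewrite !inE !xpair_eqE.
by do 2!case/orP=> /eqP->; rewrite ?eqxx ?orbT.
Qed.

End Counting.

(** * Cost of the loading of a set *)

Section LoadCost.
Variable R : realType.

(** From ln(1 - t) <= -t with t = 1/(c+2), the difference of logarithms is at least 1/(c+2); the
    factor 2 pays for replacing c+2 by c+1. *)
Lemma inv_succ_le_ln c : (c.+1%:R)^-1 <= 2 * (ln c.+2%:R - ln c.+1%:R) :> R.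
Proof.
have c2 : 0 < c.+2%:R :> R by rewrite ltr0n.
have c1 : 0 < c.+1%:R :> R by rewrite ltr0n.
have E : c.+1%:R = c.+2%:R * (1 - (c.+2%:R)^-1) :> R.
  by rewrite mulrBr mulr1 divff ?gt_eqF // -[c.+2]addn1 natrD addrK.
have d0 : 0 < 1 - (c.+2%:R)^-1 :> R by rewrite -(pmulr_rgt0 _ c2) -E.
rewrite {2}E lnM ?posrE // opprD addrA subrr add0r.
have : ln (1 - (c.+2%:R)^-1) <= - (c.+2%:R)^-1 :> R.
  by apply: le_ln1Dx; rewrite -subr_gt0 opprK addrC.
move=> h; apply: (@le_trans _ _ (2 * (c.+2%:R)^-1)); last by rewrite ler_pM2l // lerNr.
rewrite ler_pdivlMr // mulrC ler_pdivrMr //.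
by rewrite -natrM ler_nat; lia.
Qed.

Lemma ln2_ge : 2^-1 <= ln 2 :> R.
Proof. by have := inv_succ_le_ln 0; rewrite ln1 subr0; lra. Qed.

Lemma half_le_ln_succ l : (0 < l)%N -> 2^-1 <= ln l.+1%:R :> R.
Proof.
move=> l0; apply: (le_trans ln2_ge).
by rewrite ler_ln ?posrE ?ltr0n // ler_nat.
Qed.

(** Only ones contribute, and the (c+1)-th of them contributes 1/(c+1): a harmonic sum, telescoped
    by [inv_succ_le_ln]. Induction from the right keeps the prefix counts unchanged. *)
Lemma harmonic_le_ln (a : seq bool) :
  \sum_(k < size a) (if nth false a k then ((count id (take k a)).+1%:R)^-1 else 0)
  <= 2 * ln (count id a).+1%:R :> R.
Proof.
elim/last_ind: a => [|a c IHa]; first by rewrite big_ord0 ln1 mulr0.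
rewrite size_rcons big_ord_recr /= nth_rcons ltnn eqxx -cats1 take_size_cat //.
rewrite count_cat /= addn0.
have -> : \sum_(k < size a) (if nth false (a ++ [:: c]) k
      then ((count id (take k (a ++ [:: c]))).+1%:R)^-1 else 0) =
    \sum_(k < size a) (if nth false a k then ((count id (take k a)).+1%:R)^-1 else 0) :> R.
  by apply: eq_bigr => k _; rewrite nth_cat ltn_ord takel_cat // ltnW.
case: c; last by rewrite addr0 addn0.
rewrite addn1; apply: le_trans (lerD IHa (inv_succ_le_ln _)) _.
by rewrite -mulrDr addrCA subrr addr0.
Qed.

Lemma sum_nth_count (a : seq bool) :
  (\sum_(k < size a) nth false a k = count id a)%N.
Proof.
rewrite -sum1_count [RHS]big_mkcond [RHS](big_nth false) big_mkord.
by apply: eq_bigr => k _; case: (nth _ _ _).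
Qed.

Variable I : finType.
Implicit Type s : seq I.

(** With l the length, the ones cost at most 2 ln(l+1) / (3 ln(l+1)) = 2/3. The zeros cost at most 1
    / (3 ln(l+1)), which is at most 2/3 because ln(l+1) >= 1/2. *)
Lemma sparse_unit_cost s (y : input I) :
  unit_pos_cost (@sparse_load R I) s y <= 4 / 3.
Proof.
rewrite /unit_pos_cost; have [s0|s0] := posnP (size s).
  by rewrite big1 ?divr_ge0 // => -[k ks] _; move: (ks); rewrite s0.
pose a := [seq y i | i <- s]; have sa : size a = size s by rewrite size_map.
have L := half_le_ln_succ s0; set l := ln _ in L.
have l0 : 0 < l by rewrite (lt_le_trans _ L) // invr_gt0.
have sp : 0 < (size s)%:R :> R by rewrite ltr0n.
apply: (@le_trans _ _ (\sum_(k < size s) (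
   (if nth false a k then ((count id (take k a)).+1%:R)^-1 else 0) / (3 * l)
   + (3 * (size s)%:R * l)^-1))).
  apply: ler_sum => k _; rewrite /sparse_load -/a -/l.
  have [ak|ak] := boolP (nth false a k).
    rewrite eqxx -[X in X <= _]addr0; apply: lerD.
      by rewrite -invfM [X in _ <= X^-1]mulrA [_ * 3]mulrC.
    by rewrite invr_ge0 !mulr_ge0 // ltW.
  by rewrite /= mul0r add0r.
rewrite big_split /= -mulr_suml sumr_const card_ord -[X in _ + X]mulr_natl.
have -> : (size s)%:R * (3 * (size s)%:R * l)^-1 = 3^-1 * l^-1 :> R.
  by field; rewrite !gt_eqF.
have H : \sum_(k < size s) (if nth false a k
     then ((count id (take k a)).+1%:R)^-1 else 0) <= 2 * l.
  rewrite -sa; apply: (le_trans (harmonic_le_ln a)).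
  rewrite ler_pM2l // /l ler_ln ?posrE ?ltr0n // ler_nat ltnS -sa.
  exact: count_size.
have l2 : l^-1 <= 2 by rewrite -[2]invrK lef_pV2 ?posrE ?invr_gt0.
apply: (@le_trans _ _ (2 * l / (3 * l) + 3^-1 * 2)).
  apply: lerD; first by rewrite ler_wpM2r // invr_ge0 mulr_ge0 // ltW.
  by rewrite ler_wpM2l ?invr_ge0.
have -> : 2 * l / (3 * l) = 2 / 3 :> R by field; rewrite gt_eqF.
lra.
Qed.

(** With l the length and h the number of ones, a zero costs at most 3 (h+1) ln(l+1) and each of the
    h ones costs 3 l ln(l+1): the two kinds add up to l (h+1) + h l = l (2h+1). *)
Lemma sparse_neg_cost s (x : input I) :
  \sum_(k < size s) sparse_load R s x false k <=
  3 * (size s)%:R * (2 * (count x s)%:R + 1) * ln (size s).+1%:R.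
Proof.
have [s0|s0] := posnP (size s).
  rewrite big1 => [|[k ks] _]; first by rewrite s0 mulr0 !mul0r.
  by move: (ks); rewrite s0.
pose a := [seq x i | i <- s]; have sa : size a = size s by rewrite size_map.
have l0 : 0 < ln (size s).+1%:R :> R by apply: ln_succ_gt0.
set l := ln _ in l0 *.
have ca : count x s = count id a by rewrite count_map.
apply: (@le_trans _ _ (\sum_(k < size s) (3 * (count x s).+1%:R * l
   + (nth false a k)%:R * (3 * (size s)%:R * l)))).
  apply: ler_sum => k _; rewrite /sparse_load -/a -/l.
  have [ak|ak] /= := boolP (nth false a k).
    by rewrite mul1r lerDr !mulr_ge0 // ltW.
  rewrite mul0r addr0 ler_pM2r // ler_pM2l // ler_nat ltnS ca.
  by rewrite -[X in (_ <= count _ X)%N](cat_take_drop k) count_cat leq_addr.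
rewrite big_split /= sumr_const card_ord -[X in X + _]mulr_natl -mulr_suml -natr_sum.
rewrite -sa sum_nth_count sa -ca -natr1.
by rewrite le_eqVlt; apply/orP; left; apply/eqP; ring.
Qed.

Lemma dense_unit_cost s (y : input I) : unit_pos_cost (@dense_load R I) s y <= 1.
Proof.
rewrite /unit_pos_cost /dense_load sumr_const card_ord -[X in X <= _]mulr_natl.
have [->|s0] := posnP (size s); first by rewrite mul0r.
by rewrite divff // pnatr_eq0 -lt0n.
Qed.

End LoadCost.

(** * Negative complexity *)

Section Binomial.
Variables (n b : nat).
Hypothesis hb : (2 <= b <= n)%N.

(** Compares the number of initial subsets with the number N of those carrying flow, by applying
    (n-k) C(n, k) = n C(n-1, k) twice. *)
Lemma bin_ratio_start :
  ((n - (b - 2)) * (n - (b - 1)) * 'C(n, b - 2) = n * n.-1 * 'C(n - 2, b - 2))%N.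
Proof.
have := mul_bin_down n (b - 2); have := mul_bin_down n.-1 (b - 2).
have -> : (n - 2 = n.-2)%N by lia.
have -> : (n.-1 - (b - 2) = n - (b - 1))%N by lia.
move=> h1 h2; rewrite -mulnA mulnCA -h2 mulnCA -h1 mulnA mulnC.
by rewrite mulnA mulnC [('C(_, _) * _)%N]mulnC mulnA [(_ * n)%N]mulnC.
Qed.

(** The factor (n-(b-1)) C(n, b-1) is the number of super edges of Stage 2: a (b-1)-subset and a new
    vertex. *)
Lemma bin_ratio_mid :
  ((b - 1) * ((n - (b - 1)) * 'C(n, b - 1)) = n * n.-1 * 'C(n - 2, b - 2))%N.
Proof.
have := mul_bin_left n (b - 1); have := mul_bin_diag n (b - 1).
have := mul_bin_diag n.-1 (b - 2).
have -> : (n - 2 = n.-2)%N by lia.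
have -> : ((b - 2).+1 = b - 1)%N by lia.
move=> h1 h2 h3; rewrite -h3 -h2 mulnCA -h1 mulnA.
by [].
Qed.

End Binomial.

Section NegCost.
Variables (R : realType) (n m b : nat) (ch : choices n).
Hypothesis hb : (2 <= b <= n)%N.
Local Notation Z := (@with_edges n m).
Local Notation N := 'C(n - 2, b - 2).
Local Notation q := (N%:R^-1 : R).

Section Apex.
Variables (w : 'I_n) (x y0 : input (vpair n)).
Hypotheses (Zx : Z x) (Zy0 : Z y0) (hy0 : in_triangle w y0).
Local Notation K := (johnson_skeleton R m b ch w).
Local Notation c1 u s := (max_unit_pos_cost Z (in_triangle w) (jloader R u) s).
Local Notation d := #|nbh x w|.

(** The constant 4 is the positive cost 4/3 of the sparse loading times the 3 in its negative cost.
    The positive input [y0] is what makes [n_used] equal to N. *)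
Lemma stage0_neg_cost (B : {set 'I_n}) : (#|B| + 2 == b)%N ->
  \sum_(k < size (jload ch w None (Some B))) sk_weight K None (Some B) x false k
  <= q * (4 * b%:R * ln n%:R * (2 * #|nbh x w :&: B|%:R + 1)).
Proof.
move=> cB; set s := jload _ _ _ _.
under eq_bigr => k _ do rewrite johnson_weightE (n_usedE R ch hb Zy0 hy0) //.
rewrite -mulr_sumr -/s.
have c43 : c1 None s <= 4 / 3.
  by apply: bigmax_le => [|y _]; [rewrite divr_ge0|apply: sparse_unit_cost].
have S : star w B :\: set0 = star w B by rewrite setD0.
have sb : (size s <= #|B|)%N by rewrite /s /jload size_order /= S card_star.
have cx : (count x s <= #|nbh x w :&: B|)%N.
  by rewrite /s /jload count_order /= S card_star_nbh.
have Bb : (#|B| < b)%N by rewrite -(eqP cB) addn2 ltnS leqnSn.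
have bn : (b <= n)%N by case/andP: hb.
have H : \sum_(k < size s) jloader R None s x false k <=
    3 * b%:R * (2 * #|nbh x w :&: B|%:R + 1) * ln n%:R.
  apply: (le_trans (sparse_neg_cost R s x)).
  apply: ler_pM.
  - by rewrite !mulr_ge0 // ?addr_ge0 ?mulr_ge0.
  - by rewrite ln_ge0 // ler1n.
  - apply: ler_pM; rewrite ?mulr_ge0 ?addr_ge0 ?mulr_ge0 //.
      by rewrite ler_pM2l // ler_nat (leq_trans sb) // ltnW.
    by rewrite lerD2r ler_pM2l // ler_nat.
  rewrite ler_ln ?posrE ?ltr0n ?ler_nat //; last by lia.
  by rewrite (leq_trans _ bn) // (leq_trans _ Bb).
apply: (@le_trans _ _ (4 / 3 / N%:R *
    (3 * b%:R * (2 * #|nbh x w :&: B|%:R + 1) * ln n%:R))).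
  apply: ler_pM => //.
  - by rewrite divr_ge0 ?max_unit_pos_cost_ge0.
  - by apply: sumr_ge0 => k _; rewrite ltW // jloader_gt0.
  by rewrite ler_wpM2r ?invr_ge0.
by rewrite le_eqVlt; apply/orP; left; apply/eqP; field; rewrite Johnson_size_neq0.
Qed.

(** Adding j loads only the pair {w, j}, and nothing when j = w. *)
Lemma stage12_load (B : {set 'I_n}) (j : 'I_n) :
  (size (jload ch w (Some B) (Some (j |: B))) <= 1)%N.
Proof.
rewrite /jload size_order /=; apply: leq_trans (card_pair_set w j).
apply/subset_leq_card/subsetP => e; rewrite inE => /andP[eB].
rewrite inE => /existsP[v /andP[/setU1P[->|vB] E]]; first by rewrite inE.
by rewrite (mem_star _ (eqP E)) vB in eB.
Qed.

Lemma stage12_neg_cost (B : {set 'I_n}) v : sk_edge K (Some B) v ->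
  \sum_(k < size (jload ch w (Some B) v)) sk_weight K (Some B) v x false k <= q.
Proof.
move=> e; have [l2 _] := stage_edge e; have [_ [j jB Ev]] := edge_Some e.
have s1 : (size (jload ch w (Some B) v) <= 1)%N by rewrite Ev stage12_load.
set s := jload _ _ _ _ in s1 *.
under eq_bigr => k _ do rewrite johnson_weightE (n_usedE R ch hb Zy0 hy0 l2).
rewrite -mulr_sumr -/s.
have c1' : c1 (Some B) s <= 1.
  by apply: bigmax_le => // y _; apply: dense_unit_cost.
have H : \sum_(k < size s) jloader R (Some B) s x false k <= 1.
  rewrite /jloader /dense_load sumr_const card_ord.
  by case: (size s) s1 => [|[|//]] _; rewrite ?mulr0n ?mulr1n.
rewrite -[X in _ <= X]mulr1; apply: ler_pM => //.
- by rewrite divr_ge0 ?max_unit_pos_cost_ge0.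
- by apply: sumr_ge0 => k _; rewrite ltW // jloader_gt0.
by rewrite -[X in _ <= X]mul1r ler_wpM2r ?invr_ge0.
Qed.

Lemma card_edge_Some (B : {set 'I_n}) :
  (#|[pred v | sk_edge K (Some B) v]| <= n - #|B|)%N.
Proof.
have -> : (n - #|B| = #|~: B|)%N by rewrite [RHS]cardsCs setCK card_ord.
apply: leq_trans (leq_imset_card (fun j => Some (j |: B)) _).
apply/subset_leq_card/subsetP => v; rewrite inE => /edge_Some[_ [j jB ->]].
by apply: imset_f; rewrite inE.
Qed.

Lemma skeleton_neg_cost :
  \sum_u \sum_(v | sk_edge K u v) \sum_(k < size (jload ch w u v))
     sk_weight K u v x false k <=
  q * (4 * b%:R * ln n%:R * (2 * (\sum_(B : {set 'I_n} | #|B| == (b - 2)%N)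
           #|nbh x w :&: B|)%N%:R + 'C(n, b - 2)%:R)
       + ((n - (b - 2)) * 'C(n, b - 2) + (n - (b - 1)) * 'C(n, b - 1))%N%:R).
Proof.
have card_eq k : (\sum_(B : {set 'I_n} | #|B| == k) 1 = 'C(n, k))%N.
  by rewrite -[in RHS](card_ord n) -card_draws -sum1_card; apply: eq_bigl => B; rewrite inE.
rewrite sum_option mulrDr; apply: lerD.
  rewrite big_mkcond sum_option /= add0r.
  apply: (@le_trans _ _ (\sum_(B : {set 'I_n} | #|B| == (b - 2)%N)
     q * (4 * b%:R * ln n%:R * (2 * #|nbh x w :&: B|%:R + 1)))).
    rewrite [X in _ <= X]big_mkcond; apply: ler_sum => B _ /=.
    have -> : (#|B| == (b - 2)%N) = (#|B| + 2 == b)%N by apply/eqP/eqP; lia.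
    rewrite !orbF; case: ifPn => // cB; exact: stage0_neg_cost.
  rewrite -!mulr_sumr big_split /= -mulr_sumr -natr_sum.
  by rewrite -(natr_sum R _ _ (fun=> 1%N)) card_eq.
rewrite natrD mulrDr.
have E k : q * ((n - k) * 'C(n, k))%N%:R =
    \sum_(B : {set 'I_n} | #|B| == k) q * (n - #|B|)%N%:R.
  rewrite -mulr_sumr -natr_sum -card_eq big_distrr /=; congr (_ * _%:R).
  by apply: eq_bigr => B /eqP->; rewrite muln1.
rewrite !E [X in _ <= X + _]big_mkcond [X in _ <= _ + X]big_mkcond.
rewrite -big_split /=; apply: ler_sum => B _.
(* A subset with no outgoing edge contributes nothing; any outgoing edge forces the size b-2 or b-1,
   so one of the two terms on the right absorbs the contribution. *)
have [nB|[v0 e0]] : (sk_edge K (Some B) =1 xpred0) \/ exists v, sk_edge K (Some B) v.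
    by have [v e|] := pickP (sk_edge K (Some B)); [right; exists v|left].
  rewrite big_pred0 //; do 2!case: ifP => _;
  by rewrite ?addr_ge0 ?mulr_ge0 ?invr_ge0.
apply: (@le_trans _ _ (q * (n - #|B|)%N%:R)).
  apply: (@le_trans _ _ (\sum_(v | sk_edge K (Some B) v) q)).
    by apply: ler_sum => v; apply: stage12_neg_cost.
  rewrite sumr_const -[X in X <= _]mulr_natr ler_wpM2l ?invr_ge0 // ler_nat.
  exact: card_edge_Some.
have [/orP[cB|cB] _] := edge_Some e0.
  have -> : #|B| == (b - 2)%N by move: cB; lia.
  by rewrite lerDl; case: ifP => // _; rewrite mulr_ge0 ?invr_ge0.
have -> : #|B| == (b - 1)%N by move: cB; lia.
by rewrite lerDr; case: ifP => // _; rewrite mulr_ge0 ?invr_ge0.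
Qed.

Lemma plugged_neg_cost_sum :
  \sum_(B : {set 'I_n} | #|B| == b) q * neg_cost (plugged R m ch w B) x
  <= d%:R ^+ 2.
Proof.
rewrite -mulr_sumr mulrC ler_pdivrMr ?ltr0n ?Johnson_size_gt0 //.
apply: (@le_trans _ _ ((\sum_(B : {set 'I_n} | #|B| == b)
  \sum_(t : 'I_n * 'I_n | t.1 != t.2)
     ((t.1 \in nbh x w :&: B) && (t.2 \in nbh x w :&: B)))%N%:R)).
  rewrite natr_sum; apply: ler_sum => B _; rewrite natr_sum.
  exact: plugged_neg_cost.
rewrite -natrX -natrM ler_nat; apply: sum_card_draws_pairs.
by case/andP: hb.
Qed.

Variable delta : R.
Hypotheses (delta_gt0 : 0 < delta) (delta_le : delta * n%:R <= n%:R - b%:R + 1).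
Local Notation rho := (delta ^- 2).

Let n_gt0 : 0 < n%:R :> R.
Proof. by rewrite ltr0n; lia. Qed.

Let b_gt1 : 1 < b%:R :> R.
Proof. by rewrite ltr1n; lia. Qed.

(** Both n-b+2 and n-b+1 are at least delta n, so the ratio n (n-1) / ((n-b+2) (n-b+1)) is at most
    1/delta^2. *)
Lemma bin_ratio_start_le : q * 'C(n, b - 2)%:R <= rho.
Proof.
have N0 : 0 < N%:R :> R by rewrite ltr0n Johnson_size_gt0.
have dn : 0 < delta * n%:R by rewrite mulr_gt0.
rewrite mulrC ler_pdivrMr // mulrC ler_pdivlMr ?exprn_gt0 //.
rewrite -(ler_pM2r (exprn_gt0 2 n_gt0)) -mulrA -exprMn mulrC.
have /(congr1 (fun i => i%:R : R)) := bin_ratio_start hb.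
rewrite !natrM => E.
apply: (@le_trans _ _ ((n - (b - 2))%:R * (n - (b - 1))%:R * 'C(n, b - 2)%:R)).
  apply: ler_wpM2r => //; rewrite expr2; apply: ler_pM; rewrite ?(ltW dn) //.
    by apply: (le_trans delta_le); rewrite !natrB; lia || lra.
  by apply: (le_trans delta_le); rewrite !natrB; lia || lra.
rewrite E mulrC ler_wpM2l // expr2 ler_wpM2l //.
by rewrite ler_nat leq_pred.
Qed.

(** The number of extensions n-b+1 cancels in the binomial ratio, leaving n (n-1) / (b-1), and b <=
    2 (b-1) since b >= 2. *)
Lemma bin_ratio_mid_le :
  q * ((n - (b - 1)) * 'C(n, b - 1))%N%:R <= 2 * n%:R ^+ 2 / b%:R.
Proof.
have N0 : 0 < N%:R :> R by rewrite ltr0n Johnson_size_gt0.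
have /(congr1 (fun i => i%:R : R)) := bin_ratio_mid hb.
move: (_ * 'C(n, _))%N => C; rewrite !natrM => E.
have b1 : (b - 1)%:R = b%:R - 1 :> R by rewrite natrB //; lia.
rewrite b1 in E; have b10 : 0 < b%:R - 1 :> R by rewrite subr_gt0.
have -> : C%:R = n%:R * n.-1%:R * N%:R / (b%:R - 1) :> R.
  by rewrite -E mulrC mulKf // gt_eqF.
have -> : q * (n%:R * n.-1%:R * N%:R / (b%:R - 1)) = n%:R * n.-1%:R / (b%:R - 1) :> R.
  by field; rewrite !gt_eqF.
rewrite ler_pdivrMr // mulrAC ler_pdivlMr ?(lt_trans _ b_gt1) //.
have b2 : 2 <= b%:R :> R by rewrite ler_nat; case/andP: hb.
have : n.-1%:R <= n%:R :> R by rewrite ler_nat leq_pred.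
move=> h; apply: (@le_trans _ _ (n%:R * n%:R * b%:R)).
  by rewrite ler_wpM2r // ler_wpM2l.
have -> : 2 * n%:R ^+ 2 * (b%:R - 1) = n%:R * n%:R * (2 * (b%:R - 1)) :> R by ring.
by rewrite ler_pM2l ?mulr_gt0 //; lra.
Qed.

Lemma inter_ratio_le :
  q * (\sum_(B : {set 'I_n} | #|B| == (b - 2)%N) #|nbh x w :&: B|)%N%:R
  <= rho * (d%:R * b%:R / n%:R).
Proof.
have := sum_card_draws_inter (nbh x w) (b - 2)%N.
set H := (\sum_(_ | _) _)%N => /(congr1 (fun i => i%:R : R)).
rewrite !natrM => E.
have -> : H%:R = (d%:R * (b - 2)%:R / n%:R) * 'C(n, b - 2)%:R :> R.
  have n0 : n%:R != 0 :> R by rewrite gt_eqF.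
  by apply: (mulfI n0); rewrite E; field.
rewrite mulrCA [X in _ <= X]mulrC; apply: ler_pM => //.
- by rewrite !mulr_ge0 ?invr_ge0 // ltW.
- by rewrite mulr_ge0 ?invr_ge0.
- rewrite ler_wpM2r ?invr_ge0 ?(ltW n_gt0) // ler_wpM2l //.
  by rewrite ler_nat leq_subr.
exact: bin_ratio_start_le.
Qed.

Lemma johnson_neg_cost : neg_cost (johnson_graph R m b ch w) x <=
  rho * (4 * b%:R * ln n%:R * (2 * (d%:R * b%:R / n%:R) + 1) + n%:R)
  + 2 * n%:R ^+ 2 / b%:R + d%:R ^+ 2.
Proof.
apply: le_trans (neg_cost_johnson R ch w hb Zx) _.
apply: lerD plugged_neg_cost_sum; apply: (le_trans skeleton_neg_cost).
have := inter_ratio_le; have := bin_ratio_mid_le; have := bin_ratio_start_le.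
set H := (\sum_(_ | _) _)%N; set C0 := 'C(n, b - 2); set T := (_ * 'C(n, b - 1))%N.
move=> h0 h1 h2.
have L0 : 0 <= 4 * b%:R * ln n%:R :> R.
  by rewrite !mulr_ge0 // ln_ge0 // ler1n; lia.
have -> : q * (4 * b%:R * ln n%:R * (2 * H%:R + C0%:R) + ((n - (b - 2)) * C0 + T)%N%:R)
    = 4 * b%:R * ln n%:R * (2 * (q * H%:R) + q * C0%:R)
      + (n - (b - 2))%:R * (q * C0%:R) + q * T%:R :> R.
  by rewrite natrD natrM; ring.
have -> : rho * (4 * b%:R * ln n%:R * (2 * (d%:R * b%:R / n%:R) + 1) + n%:R)
    = 4 * b%:R * ln n%:R * (2 * (rho * (d%:R * b%:R / n%:R)) + rho) + n%:R * rho :> R.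
  by ring.
apply: lerD => //; apply: lerD.
  by rewrite ler_wpM2l // lerD // ler_pM2l.
apply: ler_pM => //; first by rewrite mulr_ge0 ?invr_ge0.
by rewrite ler_nat leq_subr.
Qed.

End Apex.
End NegCost.

(** * The learning graph for triangles *)

Section Triangle.
Variables (R : realType) (n m b : nat) (ch : choices n).
Hypothesis hb : (2 <= b <= n)%N.
Local Notation Z := (@with_edges n m).
Local Notation G := (triangle_graph R m b ch).

Lemma apexP y : Z y -> triangle y -> xpredT (ch_apex ch y) && in_triangle (ch_apex ch y) y.
Proof. by move=> _ /(ch_apexP ch). Qed.

Definition triangle_flow_graph :=
  or_flow_graph (fun w _ => johnson_flow_graph R m ch w hb) apexP.

Lemma triangle_learning_graph : is_learning_graph Z (@triangle n) G.
Proof.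
apply: flow_graph_learning; apply: flow_graph_term triangle_flow_graph.
move=> y [[w [?|[B [[[u v] []]|]]]]|] //= Zy hy [_ _ []] // _ [/and3P[]] //=.
move=> /setD1P[_ uB] /setD1P[_ vB] _ t _.
(* The flow stops with this label: the star contains wu and wv because u and v are in [B], and the
   last edge has loaded uv. *)
exists (star w B :|: pair_set u v) => // z Zz ag.
have agB e : e \in star w B -> z e = y e by move=> eB; apply: ag; rewrite inE eB.
case/and3P: t => wu wv uv.
apply/existsP; exists w; apply/existsP; exists u; apply/existsP; exists v.
apply/and3P; split.
- by rewrite (adj_agree _ agB) // => e E; rewrite (mem_star _ E).
- by rewrite (adj_agree _ agB) // => e E; rewrite (mem_star _ E).
by rewrite (adj_agree _ ag) // => e E; rewrite !inE E eqxx orbT.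
Qed.

Lemma triangle_C1 : C1 Z (@triangle n) G <= 1.
Proof. exact: (C1_or_le1 (fun w _ => johnson_flow_graph R m ch w hb) apexP). Qed.

Definition squared_bound (d : R) : R :=
  n%:R * (b%:R ^+ 2 * (m%:R / n%:R ^+ 2) * ln n%:R
     + n%:R ^+ 2 / b%:R ^+ 2 * (b%:R + b%:R ^+ 2 * d ^+ 2 / n%:R ^+ 2)).

Let n_gt0 : 0 < n%:R :> R.
Proof. by rewrite ltr0n; lia. Qed.

Let b_gt0 : 0 < b%:R :> R.
Proof. by rewrite ltr0n; lia. Qed.

Let ln_ge0n : 0 <= ln n%:R :> R.
Proof. by rewrite ln_ge0 // ler1n; lia. Qed.

Lemma squared_boundE d : squared_bound d =
  b%:R ^+ 2 * m%:R * ln n%:R / n%:R + n%:R ^+ 3 / b%:R + n%:R * d ^+ 2.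
Proof. by rewrite /squared_bound; field; rewrite !gt_eqF. Qed.

Lemma squared_bound_ge0 d : 0 <= squared_bound d.
Proof.
rewrite squared_boundE !addr_ge0 //; first by rewrite !mulr_ge0 ?invr_ge0.
  by rewrite mulr_ge0 ?invr_ge0 ?exprn_ge0.
by rewrite mulr_ge0 ?sqr_ge0.
Qed.

Lemma squared_bound_le d d' : 0 <= d -> d <= d' -> squared_bound d <= squared_bound d'.
Proof.
move=> d0 dd'; rewrite !squared_boundE lerD2l ler_pM2l //.
by rewrite lerXn2r ?nnegrE // (le_trans d0).
Qed.

Lemma sqr_d2 (x : input (vpair n)) :
  n%:R * d2 R x ^+ 2 = \sum_w #|nbh x w|%:R ^+ 2.
Proof.
rewrite sqr_sqrtr; last by rewrite divr_ge0 ?sumr_ge0 // => w _; rewrite sqr_ge0.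
by rewrite mulrC divfK // gt_eqF.
Qed.

Variable delta : R.
Hypotheses (delta_gt0 : 0 < delta) (delta_le : delta * n%:R <= n%:R - b%:R + 1).
Hypotheses (m_gt0 : (0 < m)%N) (b_ge : n%:R ^+ 2 / m%:R <= b%:R :> R).

Local Notation bound w x := (delta ^- 2 *
  (4 * b%:R * ln n%:R * (2 * (#|nbh x w|%:R * b%:R / n%:R) + 1) + n%:R)
  + 2 * n%:R ^+ 2 / b%:R + #|nbh x w|%:R ^+ 2).

(** If some input with m edges has a triangle through w, both factors are bounded by the estimates
    above. Otherwise [C1] is a maximum over no input, and the component weighs 0. *)
Lemma weighted_johnson_neg_cost w x : Z x ->
  C1 Z (in_triangle w) (johnson_graph R m b ch w) *
    neg_cost (johnson_graph R m b ch w) x <= 4 * bound w x.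
Proof.
move=> Zx; have rho0 : 0 <= delta ^- 2 by rewrite invr_ge0 sqr_ge0.
have [y0 /andP[Zy0 hy0]|none] := pickP (fun y => Z y && in_triangle w y).
  apply: ler_pM; rewrite ?C1_ge0 ?johnson_C1 //.
    exact: (neg_cost_ge0 (johnson_flow_graph R m ch w hb) Zx).
  exact: (johnson_neg_cost ch hb Zx Zy0 hy0).
rewrite C1_eq0 ?mul0r => [|y Zy].
  apply: mulr_ge0 => //; apply: addr_ge0; last exact: sqr_ge0.
  apply: addr_ge0; last by rewrite !mulr_ge0 ?invr_ge0 ?sqr_ge0.
  apply: mulr_ge0 => //; apply: addr_ge0 => //; apply: mulr_ge0.
    by rewrite !mulr_ge0.
  by rewrite addr_ge0 // !mulr_ge0 ?invr_ge0.
by move: (none y); rewrite Zy /= => ->.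
Qed.

Lemma triangle_neg_cost x : Z x ->
  neg_cost G x <= (80 * delta ^- 2 + 8) * squared_bound (d2 R x).
Proof.
move=> Zx.
rewrite (neg_cost_or _ (fun w _ => johnson_flow_graph R m ch w hb)).
apply: (le_trans (ler_sum _ (fun w _ => weighted_johnson_neg_cost w Zx))).
set rho := delta ^- 2; have rho0 : 0 <= rho by rewrite invr_ge0 sqr_ge0.
set L := ln n%:R; have L0 : 0 <= L := ln_ge0n.
(* The bound at w is a polynomial in the degree of w. Its coefficients are named opaquely so that
   summing over w only sees the sums of degrees and of their squares. *)
have [a1 a1E] : exists a1, a1 = 32 * rho * b%:R ^+ 2 * L / n%:R by eexists.
have [a2 a2E] : exists a2, a2 = 4 * rho * (4 * b%:R * L + n%:R) + 8 * n%:R ^+ 2 / b%:R.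
  by eexists.
rewrite (eq_bigr (fun w => a1 * #|nbh x w|%:R + a2 + 4 * #|nbh x w|%:R ^+ 2)); last first.
  by move=> w _; rewrite a1E a2E; field; rewrite !gt_eqF.
rewrite !big_split /= -!mulr_sumr sumr_const card_ord -[a2 *+ n]mulr_natl -sqr_d2.
rewrite -natr_sum; set D := (\sum_w _)%N.
have D2 : D%:R <= 2 * m%:R :> R.
  rewrite -natrM ler_nat; apply: leq_trans (sum_card_nbh x) _.
  by rewrite (eqP (Zx : #|_| == m)).
have a10 : 0 <= a1 by rewrite a1E !mulr_ge0 ?invr_ge0 ?exprn_ge0 // ltW.
have m0 : 0 < m%:R :> R by rewrite ltr0n.
have nbm : n%:R ^+ 2 <= b%:R * m%:R :> R by rewrite -ler_pdivrMr.
have bn : b%:R <= n%:R :> R by rewrite ler_nat; case/andP: hb.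
apply: (@le_trans _ _ (a1 * (2 * m%:R) + n%:R * a2 + 4 * (n%:R * d2 R x ^+ 2))).
  by rewrite !lerD2r ler_wpM2l.
rewrite squared_boundE.
set X := b%:R ^+ 2 * m%:R * L / n%:R; set Y := n%:R ^+ 3 / b%:R.
set V := n%:R * d2 R x ^+ 2.
have X0 : 0 <= X by rewrite /X !mulr_ge0 ?invr_ge0 ?exprn_ge0 // ltW.
have Y0 : 0 <= Y by rewrite /Y mulr_ge0 ?invr_ge0 ?exprn_ge0 // ltW.
have V0 : 0 <= V by rewrite /V mulr_ge0 ?sqr_ge0 // ltW.
have E1 : a1 * (2 * m%:R) = 64 * (rho * X).
  by rewrite a1E /X; field; rewrite gt_eqF.
have E2 : n%:R * a2 = 16 * (rho * (n%:R * b%:R * L)) + 4 * (rho * n%:R ^+ 2) + 8 * Y.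
  by rewrite a2E /Y; field; rewrite gt_eqF.
(* The [+ 1] in the cost of Stage 0 sums to n b log n; it is absorbed by b^2 m log n / n exactly
   because n^2 <= b m. *)
have h1 : rho * (n%:R * b%:R * L) <= rho * X.
  rewrite ler_wpM2l // /X ler_pdivlMr //.
  have -> : n%:R * b%:R * L * n%:R = n%:R ^+ 2 * (b%:R * L) by ring.
  have -> : b%:R ^+ 2 * m%:R * L = b%:R * m%:R * (b%:R * L) by ring.
  by rewrite ler_wpM2r // mulr_ge0 // ltW.
(* The n super edges per component from Stage 1 sum to n^2, which is at most n^3/b as b <= n. *)
have h2 : rho * n%:R ^+ 2 <= rho * Y.
  rewrite ler_wpM2l // /Y ler_pdivlMr // [X in _ <= X]exprSr.
  by rewrite ler_wpM2l // sqr_ge0.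
have rX : 0 <= rho * X by rewrite mulr_ge0.
have rY : 0 <= rho * Y by rewrite mulr_ge0.
have rV : 0 <= rho * V by rewrite mulr_ge0.
rewrite E1 E2.
(* 80 is 64, from the sparse loading, plus 16, from the term just absorbed into [X]; 8 is the
   coefficient of [Y] left by Stage 2. *)
have -> : (80 * rho + 8) * (X + Y + V) =
  80 * (rho * X) + 80 * (rho * Y) + 80 * (rho * V) + 8 * X + 8 * Y + 8 * V by ring.
lra.
Qed.

(** As [C1] is at most 1, only the negative cost matters. The maximum over negative inputs is
    bounded through the monotonicity of the bound in d_2. *)
Lemma triangle_complexity :
  let K := Num.sqrt (80 * delta ^- 2 + 8) in
  (forall x : input (vpair n), Z x -> ~~ triangle x ->
     Num.sqrt (neg_cost G x * C1 Z (@triangle n) G)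
       <= K * triangle_bound n m b (d2 R x))
  /\ complexity Z (@triangle n) G <= K * triangle_bound n m b (max_d2 R n m).
Proof.
have K0 : 0 <= 80 * delta ^- 2 + 8 by rewrite addr_ge0 // mulr_ge0 ?invr_ge0 ?sqr_ge0.
have le d c : 0 <= c -> c <= (80 * delta ^- 2 + 8) * squared_bound d ->
    Num.sqrt (c * C1 Z (@triangle n) G)
    <= Num.sqrt (80 * delta ^- 2 + 8) * triangle_bound n m b d.
  move=> c0 cd; rewrite -sqrtrM // ler_wsqrtr //; apply: le_trans cd.
  by rewrite -[X in _ <= X]mulr1 ler_wpM2l // triangle_C1.
split=> [x Zx nx|].
  apply: le; last exact: triangle_neg_cost.
  exact: (neg_cost_ge0 triangle_flow_graph Zx).
apply: le; first exact: C0_ge0.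
apply: bigmax_le => [|x xP]; first by rewrite mulr_ge0 ?squared_bound_ge0.
have /andP[Zx _] := xP; apply: (le_trans (triangle_neg_cost Zx)).
rewrite ler_wpM2l // squared_bound_le ?sqrtr_ge0 //.
rewrite /max_d2; exact: (le_bigmax_cond _ (fun x => d2 R x) xP).
Qed.

End Triangle.

(** * The optimal choice of b *)

Section Optimal.
Variables (R : realType) (n m b : nat).
Hypotheses (hb : (2 <= b <= n)%N) (b_opt : `|b%:R - optimal_b R n m| < 1).
Hypotheses (m_gt0 : (0 < m)%N) (b_ge : n%:R ^+ 2 / m%:R <= b%:R :> R).
Local Notation a := (n%:R `^ (1 / 6) : R).
Local Notation l := ((m%:R * ln n%:R) `^ (1 / 6) : R).

Let n_gt0 : 0 < n%:R :> R.
Proof. by rewrite ltr0n; lia. Qed.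

Let m0 : 0 < m%:R :> R.
Proof. by rewrite ltr0n. Qed.

Let b_ge2 : 2 <= b%:R :> R.
Proof. by rewrite ler_nat; case/andP: hb. Qed.

Let b_le : b%:R <= n%:R :> R.
Proof. by rewrite ler_nat; case/andP: hb. Qed.

Let ln_n_gt0 : 0 < ln n%:R :> R.
Proof. by rewrite ln_gt0 // ltr1n; lia. Qed.

Let a_gt0 : 0 < a.
Proof. exact: powR_gt0. Qed.

Let l_gt0 : 0 < l.
Proof. by rewrite powR_gt0 // mulr_gt0. Qed.

(** All exponents are multiples of 1/6. In the sixth roots [a] of n and [l] of m log n, every
    quantity becomes a monomial with integer exponents. *)
Let powR6 (x : R) k : 0 <= x -> x `^ (k%:R / 6) = (x `^ (1 / 6)) ^+ k.
Proof.
move=> x0; rewrite -powR_mulrn ?powR_ge0 // -powRrM.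
by congr (_ `^ _); rewrite div1r mulrC.
Qed.

Let nE : n%:R = a ^+ 6 :> R.
Proof. by rewrite -powR6 // divff ?powRr1 // pnatr_eq0. Qed.

Let lE : m%:R * ln n%:R = l ^+ 6 :> R.
Proof.
have mL : 0 <= m%:R * ln n%:R :> R by rewrite mulr_ge0 // ltW.
by rewrite -powR6 // divff ?powRr1 // pnatr_eq0.
Qed.

Lemma optimal_bE : optimal_b R n m = a ^+ 8 / l ^+ 2.
Proof.
have mL : 0 <= m%:R * ln n%:R :> R by rewrite mulr_ge0 // ltW.
rewrite /optimal_b -!powR6 ?(ltW n_gt0) //.
by congr (_ `^ _ / _ `^ _); field.
Qed.

Lemma optimal_boundE (d : R) :
  optimal_bound n m d = a ^+ 5 * l + d * Num.sqrt n%:R :> R.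
Proof.
by rewrite /optimal_bound -powR6 // ltW.
Qed.

(** Rounding changes the value by less than 1, which is at most b/2 because b >= 2. The next bound
    uses the same remark in the other direction. *)
Let b_le_opt : b%:R <= 2 * optimal_b R n m.
Proof. by move: b_opt b_ge2; rewrite ltr_norml => /andP[]; lra. Qed.

Let opt_le_b : optimal_b R n m <= 3 / 2 * b%:R.
Proof. by move: b_opt b_ge2; rewrite ltr_norml => /andP[]; lra. Qed.

(** Let u = n^(5/6) (m log n)^(1/6) and v = d sqrt(n). The optimal b balances the first two terms:
    up to rounding both equal u^2, so they are at most 4 u^2 and (3/2) u^2. The third term is v^2,
    and the sum is below 9 (u + v)^2. *)
Lemma triangle_bound_optimal (d : R) : 0 <= d ->
  triangle_bound n m b d <= 3 * optimal_bound n m d.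
Proof.
move=> d0; have b0 : 0 < b%:R :> R by apply: lt_le_trans b_ge2.
have := b_le_opt; have := opt_le_b; have := optimal_boundE d; rewrite optimal_bE.
move: a_gt0 l_gt0 nE lE; move: a l => r s r0 s0 nE' mlE -> opt_b b_opt'.
rewrite -[X in _ <= X]ger0_norm; last first.
  by rewrite mulr_ge0 ?addr_ge0 ?mulr_ge0 ?sqrtr_ge0 ?exprn_ge0 // ltW.
rewrite -sqrtr_sqr ler_wsqrtr // -/(squared_bound n m b d) squared_boundE //.
have E1 : b%:R ^+ 2 * m%:R * ln n%:R / n%:R <= 4 * (r ^+ 5 * s) ^+ 2.
  rewrite ler_pdivrMr // -mulrA mlE.
  have -> : 4 * (r ^+ 5 * s) ^+ 2 * n%:R = (2 * (r ^+ 8 / s ^+ 2)) ^+ 2 * s ^+ 6 :> R.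
    by rewrite nE'; field; rewrite gt_eqF.
  rewrite ler_pM2r ?exprn_gt0 // lerXn2r ?nnegrE ?(ltW b0) //.
  by rewrite mulr_ge0 // divr_ge0 // exprn_ge0 // ltW.
have E2 : n%:R ^+ 3 / b%:R <= 3 / 2 * (r ^+ 5 * s) ^+ 2.
  rewrite ler_pdivrMr //.
  have -> : n%:R ^+ 3 = (r ^+ 5 * s) ^+ 2 * (r ^+ 8 / s ^+ 2) :> R.
    by rewrite nE'; field; rewrite gt_eqF.
  rewrite mulrC [X in _ <= X]mulrAC; apply: ler_wpM2r => //.
  exact: sqr_ge0.
have E3 : n%:R * d ^+ 2 = (d * Num.sqrt n%:R) ^+ 2.
  by rewrite exprMn sqr_sqrtr ?(ltW n_gt0) // mulrC.
rewrite E3; set u := r ^+ 5 * s in E1 E2 *.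
set v := d * _.
have u0 : 0 <= u by rewrite mulr_ge0 ?exprn_ge0 // ltW.
have v0 : 0 <= v by rewrite mulr_ge0 ?sqrtr_ge0.
have uv : 0 <= u * v by rewrite mulr_ge0.
have u2 : 0 <= u ^+ 2 by rewrite sqr_ge0.
have v2 : 0 <= v ^+ 2 by rewrite sqr_ge0.
have -> : (3 * (u + v)) ^+ 2 = 9 * u ^+ 2 + 18 * (u * v) + 9 * v ^+ 2 by ring.
lra.
Qed.

(** Let B be the optimal value. Then B^3 m log n = n^4, while n^2 <= b m <= 2 B m; dividing gives
    B^2 log n <= 2 n^2. With log n >= 4 this is B^2 <= n^2/2, below (3n/4)^2. *)
Lemma optimal_b_le : 4 <= ln n%:R :> R -> optimal_b R n m <= 3 / 4 * n%:R.
Proof.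
move=> L4; have bB := b_le_opt; set B := optimal_b R n m in bB *.
have B0 : 0 < B by move: b_ge2 bB; lra.
have B3 : B ^+ 3 * (m%:R * ln n%:R) = n%:R ^+ 4.
  rewrite /B optimal_bE; move: a_gt0 l_gt0 nE lE; move: a l => r s r0 s0 nE' ->.
  by rewrite nE'; field; rewrite gt_eqF.
have nbm : n%:R ^+ 2 <= b%:R * m%:R :> R by rewrite -ler_pdivrMr.
have nBm : n%:R ^+ 2 <= 2 * B * m%:R by apply: (le_trans nbm); rewrite ler_pM2r.
have h : B ^+ 2 * ln n%:R <= 2 * n%:R ^+ 2.
  rewrite -(ler_pM2l (mulr_gt0 B0 m0)).
  have -> : B * m%:R * (B ^+ 2 * ln n%:R) = n%:R ^+ 2 * n%:R ^+ 2.
    by rewrite -exprD -B3; ring.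
  have -> : B * m%:R * (2 * n%:R ^+ 2) = 2 * B * m%:R * n%:R ^+ 2 by ring.
  by rewrite ler_pM2r ?exprn_gt0.
have h2 : B ^+ 2 * 4 <= 2 * n%:R ^+ 2.
  by apply: le_trans h; rewrite ler_wpM2l ?sqr_ge0.
have p0 : 0 <= 3 / 4 * n%:R :> R by apply: mulr_ge0 => //; apply: divr_ge0.
rewrite -(@ler_pXn2r _ 2) ?nnegrE ?(ltW B0) //.
have N0 : 0 <= n%:R ^+ 2 :> R by rewrite sqr_ge0.
have -> : (3 / 4 * n%:R) ^+ 2 = 9 / 16 * n%:R ^+ 2 :> R by field.
lra.
Qed.

(** For n < 256 the right side is at least 1 because b <= n. For n >= 256 = 2^8, ln n >= 8 ln 2 >= 4
    by the crude bound ln 2 >= 1/2, so b < 3n/4 + 1 and the right side exceeds n/4. *)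
Lemma optimal_delta : 256^-1 * n%:R <= n%:R - b%:R + 1 :> R.
Proof.
have [n256|n256] := leqP 256 n; last first.
  have : n%:R <= 256 :> R by rewrite ler_nat ltnW.
  by move: b_le; lra.
have L4 : 4 <= ln n%:R :> R.
  have : ln (2 ^+ 8) <= ln n%:R :> R.
    by rewrite ler_ln ?posrE ?exprn_gt0 // -natrX ler_nat.
  by rewrite lnXn // -[ln 2 *+ 8]mulr_natl => h; have := ln2_ge R; lra.
have := optimal_b_le L4; move: b_opt n_gt0; rewrite ltr_norml => /andP[_ h1] h2 h3.
lra.
Qed.

End Optimal.

Theorem theorem5p3 (R : realType) :
  (forall (n m b : nat) (ch : choices n), (2 <= b <= n)%N ->
     is_learning_graph (with_edges m) (@triangle n)
       (triangle_graph R m b ch))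
  /\
  (* the implied constant depends on an upper bound c < 1 on b / n *)
  (forall c : R, c < 1 -> exists K : R,
     forall (n m b : nat) (ch : choices n),
       (2 <= b <= n)%N -> b%:R <= c * n%:R ->
       (0 < m)%N -> n%:R ^+ 2 / m%:R <= b%:R :> R ->
       let G := triangle_graph R m b ch in
       let C := C1 (with_edges m) (@triangle n) G in
       (forall x : input (vpair n), with_edges m x -> ~~ triangle x ->
          Num.sqrt (neg_cost G x * C) <= K * triangle_bound n m b (d2 R x))
       /\ complexity (with_edges m) (@triangle n) G
          <= K * triangle_bound n m b (max_d2 R n m))
  /\
  (* b = n^(4/3) / (m log n)^(1/3), rounded up or down *)
  (exists K : R,
     forall (n m b : nat) (ch : choices n),
       (2 <= b <= n)%N -> `|b%:R - optimal_b R n m| < 1 ->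
       (0 < m)%N -> n%:R ^+ 2 / m%:R <= b%:R :> R ->
       let G := triangle_graph R m b ch in
       let C := C1 (with_edges m) (@triangle n) G in
       (forall x : input (vpair n), with_edges m x -> ~~ triangle x ->
          Num.sqrt (neg_cost G x * C) <= K * optimal_bound n m (d2 R x))
       /\ complexity (with_edges m) (@triangle n) G
          <= K * optimal_bound n m (max_d2 R n m)).
Proof.
split; [|split].
- by move=> n m b ch hb; apply: triangle_learning_graph.
(* Here [delta] is 1 - c: from b <= c n follows n - b + 1 >= (1 - c) n. *)
- move=> c c1; exists (Num.sqrt (80 * (1 - c) ^- 2 + 8)).
  move=> n m b ch hb bc m0 bm; apply: triangle_complexity => //.
    by rewrite subr_gt0.
  by rewrite mulrBl mul1r; lra.
(* Here [delta] is 1/256, from [optimal_delta], and the factor 3 comes from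
   [triangle_bound_optimal]. *)
exists (Num.sqrt (80 * (256^-1) ^- 2 + 8) * 3) => n m b ch hb bopt m0 bm.
have d0 : 0 < 256^-1 :> R by rewrite invr_gt0.
have [h1 h2] := triangle_complexity ch hb d0
  (optimal_delta hb bopt m0 bm) m0 bm.
have le d : 0 <= d -> Num.sqrt (80 * (256^-1) ^- 2 + 8) * triangle_bound n m b d
    <= Num.sqrt (80 * (256^-1) ^- 2 + 8) * 3 * optimal_bound n m d :> R.
  by move=> dge0; rewrite -mulrA ler_wpM2l ?sqrtr_ge0 // triangle_bound_optimal.
split=> [x Zx nx|].
  by apply: le_trans (h1 x Zx nx) (le _ _); apply: sqrtr_ge0.
by apply: le_trans h2 (le _ _); apply: bigmax_ge_id.
Qed.
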